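(* Fix $\kappa\ge0$. Let $(A_0,B_0)\in\mathcal{D}\setminus\mathcal{D}_0$ with $X_2(A_0,B_0)\ne0$. Choose $(q(0),\xi(0))\in\mathbb{R}^3_+\times\mathbb{R}^3$ such that $\Phi\circ\Gamma\circ\Psi(q(0),\xi(0))=(A_0,B_0)$. Let $(q,\xi)\in C^1(\mathbb{R},\mathbb{R}^3_+\times\mathbb{R}^3)$ be the global solution, with initial data $(q(0),\xi(0))$, of the system $$\begin{aligned}&\dot q_1=\frac{(2+q_1^2)\xi_1}{2(1+q_1^2)},&&\dot\xi_1=\left(\frac{\xi_1^2}{2(1+q_1^2)^2}+\frac{\xi_2^2}{q_1^4}+\frac{\xi_3^2}{(2+q_1^2)^2}-2\kappa\right)q_1,\\&\dot q_2=\frac{\xi_2}{q_1^2},&&\dot\xi_2=0,\\&\dot q_3=\frac{\xi_3}{2+q_1^2},&&\dot\xi_3=0.\end{aligned}$$ Then $A(t)=\varphi\circ\psi\circ q(t)$, $t\in\mathbb{R}$, is the solution in $C^0(\mathbb{R},\mathrm{SL}(2,\mathbb{R}))\cap C^2(\mathbb{R},\mathbb{M}^2)$ of $$\ddot A(t)+\kappa A(t)=\lambda(t)\,\mathrm{cof}\,A(t)$$ with initial data $(A(0),\dot A(0))=(A_0,B_0)$. Explicitly, $$A(t)=\tfrac1{\sqrt2}\,U\!\left(\tfrac12(q_3(t)+q_2(t))\right)\left(\rho(t)I+q_1(t)K\right)U\!\left(\tfrac12(q_3(t)-q_2(t))\right),\qquad \rho(t)=(2+q_1(t)^2)^{1/2}.$$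 There holds $\tfrac12|A(t)|^2=1+q_1(t)^2$, and the fluid domain $\Omega(t)=A(t)\mathcal{B}$ is an ellipse with principal semi-axes of lengths $$\tfrac1{\sqrt2}\left[\left(\tfrac12|A(t)|^2+1\right)^{1/2}\pm\left(\tfrac12|A(t)|^2-1\right)^{1/2}\right],$$ for all $t\in\mathbb{R}$.
   Context: $\mathbb{M}^2$ is the space of real $2\times2$ matrices with inner product $\langle A,B\rangle=\mathrm{tr}(A^\top B)$ and norm $|A|=\langle A,A\rangle^{1/2}$. $\mathrm{SL}(2,\mathbb{R})=\{\det A=1\}$; $\mathrm{SO}(2,\mathbb{R})$ is the rotation group. $I=\begin{bmatrix}1&0\\0&1\end{bmatrix}$, $Z=\begin{bmatrix}0&-1\\1&0\end{bmatrix}$, $K=\begin{bmatrix}1&0\\0&-1\end{bmatrix}$, $M=\begin{bmatrix}0&1\\1&0\end{bmatrix}$; $U(\theta)=\cos\theta\,I+\sin\theta\,Z$; $\mathrm{cof}\,A=ZAZ^\top$ is the cofactor matrix. $\mathcal{D}=\{(A,B):\det A=1,\ \langle B,\mathrm{cof}\,A\rangle=0\}$ is the tangent bundle of $\mathrm{SL}(2,\mathbb{R})$ and $\mathcal{D}_0=\{(A,B)\in\mathcal{D}:A\in\mathrm{SO}(2,\mathbb{R})\}$. $X_2(A,B)=\tfrac12\langle ZA-AZ,B\rangle$. $\mathcal{B}\subset\mathbb{R}^2$ is the closed unit disk. A solution of $\ddot A+\kappa A=\lambda\,\mathrm{cof}\,A$ means that the equation holds for some $\lambda\in C^0(\mathbb{R},\mathbb{R})$;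 for an $\mathrm{SL}(2,\mathbb{R})$-valued solution necessarily $\lambda(t)=2(\kappa-\det\dot A(t))/|A(t)|^2$, and the solution with given initial data in $\mathcal{D}$ exists and is unique. For $x\in\mathbb{R}^3$: $\varphi(x)=\tfrac1{\sqrt2}\big((2+x_1^2+x_2^2)^{1/2}(\cos x_3\,I+\sin x_3\,Z)+x_1K+x_2M\big)$ and $g(x)=D_x\varphi(x)^\top D_x\varphi(x)$ (an invertible $3\times3$ matrix). $\Phi(x,y)=(\varphi(x),D_x\varphi(x)y)$, $\Gamma(x,p)=(x,g^{-1}(x)p)$. $\psi(q)=(q_1\cos q_2,\,q_1\sin q_2,\,q_3)$, $\mathbb{R}^3_+=\{q\in\mathbb{R}^3:q_1>0\}$, and $\Psi(q,\xi)=(\psi(q),D\psi(q)^{-\top}\xi)$ for $(q,\xi)\in\mathbb{R}^3_+\times\mathbb{R}^3$. The map $\Phi\circ\Gamma\circ\Psi$ sends $\mathbb{R}^3_+\times\mathbb{R}^3$ onto $\mathcal{D}\setminus\mathcal{D}_0$. *)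

(* Defs.v *)
From HB Require Import structures.
From mathcomp Require Import all_boot all_order all_algebra.
From mathcomp Require Import all_classical all_reals all_analysis.

Set Implicit Arguments.
Unset Strict Implicit.
Unset Printing Implicit Defensive.

Import Order.TTheory GRing.Theory Num.Theory.
Import numFieldNormedType.Exports.

Local Open Scope ring_scope.
Local Open Scope classical_set_scope.

(* Points of R^n are column vectors 'cV[R]_n.  Coordinates are numbered from
   0: the coordinates q_1, q_2, q_3 of the mathematical text are
   [q 0 0], [q 1 0], [q 2 0]. *)

Definition vec3 {R : realType} (a b c : R) : 'cV[R]_3 :=
  \col_(i < 3) nth 0 [:: a; b; c] i.

Definition mx2 {R : realType} (a b c d : R) : 'M[R]_2 :=
  \matrix_(i < 2, j < 2) nth 0 (nth [::] [:: [:: a; b]; [:: c; d]] i) j.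

Definition matI {R : realType} : 'M[R]_2 := 1%:M.
Definition matZ {R : realType} : 'M[R]_2 := mx2 0 (-1) 1 0.
Definition matK {R : realType} : 'M[R]_2 := mx2 1 0 0 (-1).
Definition matM {R : realType} : 'M[R]_2 := mx2 0 1 1 0.

Definition matU {R : realType} (theta : R) : 'M[R]_2 :=
  cos theta *: matI + sin theta *: matZ.

Definition inner {R : realType} (A B : 'M[R]_2) : R := \tr (A^T *m B).

(* The norm |A| of the text; the library norm [`|A|] is the sup norm. *)
Definition frob {R : realType} (A : 'M[R]_2) : R := Num.sqrt (inner A A).

Definition cof {R : realType} (A : 'M[R]_2) : 'M[R]_2 :=
  matZ *m A *m matZ^T.

Definition SL2 {R : realType} : set 'M[R]_2 := [set A | \det A = 1].

Definition SO2 {R : realType} : set 'M[R]_2 :=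
  [set A | A^T *m A = 1%:M /\ \det A = 1].

Definition calD {R : realType} : set ('M[R]_2 * 'M[R]_2) :=
  [set AB | \det AB.1 = 1 /\ inner AB.2 (cof AB.1) = 0].

Definition calD0 {R : realType} : set ('M[R]_2 * 'M[R]_2) :=
  [set AB | calD AB /\ SO2 AB.1].

Definition X2 {R : realType} (A B : 'M[R]_2) : R :=
  2^-1 * inner (matZ *m A - A *m matZ) B.

Definition phi {R : realType} (x : 'cV[R]_3) : 'M[R]_2 :=
  (Num.sqrt 2)^-1 *:
    (Num.sqrt (2 + x 0 0 ^+ 2 + x 1 0 ^+ 2) *:
       (cos (x 2 0) *: matI + sin (x 2 0) *: matZ)
     + x 0 0 *: matK + x 1 0 *: matM).

(* The matrix of (D phi)^T D phi, the transpose (adjoint) being taken with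
   respect to [inner] on 2x2 matrices and the Euclidean inner product on R^3. *)
Definition metric {R : realType} (x : 'cV[R]_3) : 'M[R]_3 :=
  \matrix_(i < 3, j < 3)
    inner ('d phi x (delta_mx i 0)) ('d phi x (delta_mx j 0)).

Definition Phi {R : realType} (z : 'cV[R]_3 * 'cV[R]_3) :
    'M[R]_2 * 'M[R]_2 :=
  (phi z.1, 'd phi (z.1) z.2).

Definition Gamma {R : realType} (z : 'cV[R]_3 * 'cV[R]_3) :
    'cV[R]_3 * 'cV[R]_3 :=
  (z.1, invmx (metric z.1) *m z.2).

Definition psi {R : realType} (q : 'cV[R]_3) : 'cV[R]_3 :=
  vec3 (q 0 0 * cos (q 1 0)) (q 0 0 * sin (q 1 0)) (q 2 0).

(* The library's [jacobian] acts on row vectors; this is the usual Jacobian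
   matrix of a map between column vectors, whose j-th column is the partial
   derivative in direction j. *)
Definition jac {R : realType} (f : 'cV[R]_3 -> 'cV[R]_3) (x : 'cV[R]_3) :
    'M[R]_3 :=
  \matrix_(i < 3, j < 3) ('d f x (delta_mx j 0) : 'cV[R]_3) i 0.

Definition Psi {R : realType} (z : 'cV[R]_3 * 'cV[R]_3) :
    'cV[R]_3 * 'cV[R]_3 :=
  (psi z.1, (invmx (jac psi z.1))^T *m z.2).

Definition R3plus {R : realType} : set 'cV[R]_3 := [set q | 0 < q 0 0].

Definition Ck {R : realType} {V : normedModType R} (k : nat) (f : R -> V) :
    Prop :=
  (forall j t, (j < k)%N -> derivable (f^`(j)) t 1) /\ continuous (f^`(k)).

Definition global_solution {R : realType} (kappa : R) (q0 xi0 : 'cV[R]_3)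
    (q xi : R -> 'cV[R]_3) : Prop :=
  [/\ Ck 1 q, Ck 1 xi, (forall t, R3plus (q t)), (q 0 = q0 /\ xi 0 = xi0)
    & forall t,
      let q1 := q t 0 0 in
      let xi1 := xi t 0 0 in let xi2 := xi t 1 0 in let xi3 := xi t 2 0 in
      (q^`() t = vec3 ((2 + q1 ^+ 2) * xi1 / (2 * (1 + q1 ^+ 2)))
                      (xi2 / q1 ^+ 2)
                      (xi3 / (2 + q1 ^+ 2))) /\
      (xi^`() t = vec3 ((xi1 ^+ 2 / (2 * (1 + q1 ^+ 2) ^+ 2)
                         + xi2 ^+ 2 / q1 ^+ 4
                         + xi3 ^+ 2 / (2 + q1 ^+ 2) ^+ 2
                         - 2 * kappa) * q1)
                       0 0)].

Definition SL2_solution {R : realType} (kappa : R) (A0 B0 : 'M[R]_2)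
    (A : R -> 'M[R]_2) : Prop :=
  [/\ (continuous A /\ forall t, SL2 (A t)), Ck 2 A,
      (exists lambda : R -> R, continuous lambda /\
         forall t, (A^`(2))%classic t + kappa *: A t = lambda t *: cof (A t))
    & A 0 = A0 /\ A^`() 0 = B0].

Definition unit_disk {R : realType} : set 'cV[R]_2 :=
  [set y | y 0 0 ^+ 2 + y 1 0 ^+ 2 <= 1].

(* The solid ellipse. *)
Definition is_ellipse {R : realType} (a b : R) (S : set 'cV[R]_2) : Prop :=
  [/\ 0 < a, 0 < b &
    exists (c : 'cV[R]_2) (Q : 'M[R]_2), Q^T *m Q = 1%:M /\
      S = [set c + Q *m y | y in
            [set y : 'cV[R]_2 | (y 0 0 / a) ^+ 2 + (y 1 0 / b) ^+ 2 <= 1]]].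

(* Main.v *)
Require Import Defs.
From HB Require Import structures.
From mathcomp Require Import all_boot all_order all_algebra.
From mathcomp Require Import all_classical all_reals all_analysis.
From mathcomp Require Import ring lra.
Import Order.TTheory GRing.Theory Num.Theory.
Import numFieldNormedType.Exports.
Local Open Scope ring_scope.
Local Open Scope classical_set_scope.

Set Implicit Arguments.
Unset Strict Implicit.
Unset Printing Implicit Defensive.

(** The system is the Hamiltonian form of the motion of a point of SL(2, R) in
    coordinates where the metric is diagonal.  Write
    [rho = sqrt (2 + q1 ^+ 2)].  In the basis I, Z, K, M the matrix
    [phi (psi q)] is, up to the factor [1 / sqrt 2], a pair of plane vectors:
    one of length [rho] and angle [q3], one of length [q1] and angle [q2].  Both
    move with constant angular momentum, [xi3] and [xi2] respectively, so each
    has an acceleration parallel to its position, say with factors [m1] and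
    [m2] ([polar_curve]).  The cofactor map fixes I and Z and negates K and M,
    so the matrix equation amounts to [m1 + kappa = lambda] and
    [m2 + kappa = - lambda], that is [m1 + m2 + 2 kappa = 0]: this identity is
    the equation for the radial momentum ([motion_derivatives]).

    The initial velocity is right because the differential of [psi] pulls the
    metric back to a diagonal matrix ([metric_polar]), whose inverse turns the
    momentum [xi] into the velocity of the Hamiltonian system ([Gamma_Psi]).
    The matrix solution is unique since differentiating [det A = 1] twice
    determines the multiplier ([SL2_multiplier]), after which the equation is
    locally Lipschitz in the pair formed by [A] and its derivative.

    The Hamiltonian system has a global solution because [X2 (A0, B0)] is the
    constant momentum [xi2] ([X2_polar]).  As it does not vanish, conservation
    of energy bounds [q1] away from zero and bounds [xi1].  The radial equation
    can therefore be replaced by a globally Lipschitz one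
    ([radial_field_lipschitz]), solved on the whole line by Picard iteration
    ([picard_lindelof]), and energy shows that the solution never meets the
    region where the two equations differ ([radial_motion]).  The angles are
    then primitives of continuous functions.

    Finally [phi (psi q)] is a rotation times the diagonal matrix with entries
    [(rho + q1) / sqrt 2] and [(rho - q1) / sqrt 2] times a rotation
    ([phi_psi_svd]), and the image of the disk is read off this singular value
    decomposition ([ellipse_of_svd]). *)

(** * Differentiation of real functions *)

Lemma is_derive_add {R : realType} (f g : R -> R) (t a b : R) :
  is_derive t 1 f a -> is_derive t 1 g b ->
  is_derive t 1 (fun s => f s + g s) (a + b).
Proof. by move=> ? ?; apply: is_deriveD. Qed.

Lemma is_derive_opp {R : realType} (f : R -> R) (t a : R) :
  is_derive t 1 f a -> is_derive t 1 (fun s => - f s) (- a).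
Proof. by move=> ?; apply: is_deriveN. Qed.

Lemma is_derive_mul {R : realType} (f g : R -> R) (t a b : R) :
  is_derive t 1 f a -> is_derive t 1 g b ->
  is_derive t 1 (fun s => f s * g s) (f t * b + g t * a).
Proof. by move=> ? ?; apply: is_deriveM. Qed.

Lemma is_derive_exprn {R : realType} (f : R -> R) (n : nat) (t a : R) :
  is_derive t 1 f a ->
  is_derive t 1 (fun s => f s ^+ n) (n%:R * f t ^+ n.-1 * a).
Proof.
move=> fa; have := is_deriveX n fa.
rewrite (_ : f ^+ n = fun s => f s ^+ n)//.
by apply/funext => s; rewrite exprfctE.
Qed.

Lemma is_derive_inv {R : realType} (f : R -> R) (t a : R) :
  f t != 0 -> is_derive t 1 f a ->
  is_derive t 1 (fun s => (f s)^-1) (- (f t) ^- 2 * a).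
Proof. by move=> ? ?; apply: is_deriveV. Qed.

Lemma is_derive_comp1 {R : realType} (g f : R -> R) (t a b : R) :
  is_derive (f t) 1 g b -> is_derive t 1 f a ->
  is_derive t 1 (fun s => g (f s)) (b * a).
Proof. by move=> ? ?; apply: is_derive1_comp. Qed.

Lemma is_derive_sqrt {R : realType} (f : R -> R) (t a : R) :
  0 < f t -> is_derive t 1 f a ->
  is_derive t 1 (fun s => Num.sqrt (f s)) ((2 * Num.sqrt (f t))^-1 * a).
Proof. by move=> ? ?; apply: is_derive_comp1; exact: is_derive1_sqrt. Qed.

(** Differentiates a real function of one variable along the syntax of its
    body; unknown functions are differentiated with the hypotheses at hand. *)
Ltac isder_step :=
  match goal with
  | |- is_derive _ _ (fun _ => ?c) _ => exact: is_derive_cst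
  | |- is_derive _ _ (fun s => s) _ => exact: is_derive_id
  | H : forall x, is_derive x _ ?f _ |- is_derive _ _ ?f _ =>
      notypeclasses refine (H _)
  | H : is_derive _ _ ?f _ |- is_derive _ _ ?f _ => exact H
  | |- is_derive _ _ (fun s => @?f s + @?g s) _ =>
      notypeclasses refine (is_derive_add _ _); isder_step
  | |- is_derive _ _ (fun s => - @?f s) _ =>
      notypeclasses refine (is_derive_opp _); isder_step
  | |- is_derive _ _ (fun s => @?f s * @?g s) _ =>
      notypeclasses refine (is_derive_mul _ _); isder_step
  | |- is_derive _ _ (fun s => @?f s ^+ ?n) _ =>
      notypeclasses refine (is_derive_exprn _ _); isder_step
  | |- is_derive _ _ (fun s => cos (@?f s)) _ =>
      notypeclasses refine (is_derive_comp1 (is_derive_cos _) _); isder_step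
  | |- is_derive _ _ (fun s => sin (@?f s)) _ =>
      notypeclasses refine (is_derive_comp1 (is_derive_sin _) _); isder_step
  | |- is_derive _ _ (fun s => expR (@?f s)) _ =>
      notypeclasses refine (is_derive_comp1 (is_derive_expR _) _); isder_step
  | |- is_derive _ _ (fun s => Num.sqrt (@?f s)) _ =>
      notypeclasses refine (is_derive_sqrt _ _); [ | isder_step]
  | |- is_derive _ _ (fun s => (@?f s)^-1) _ =>
      notypeclasses refine (is_derive_inv _ _); [ | isder_step]
  | |- is_derive ?t ?v (GRing.mul ?c) ?d =>
      change (is_derive t v (fun s => c * s) d); isder_step
  | |- is_derive ?t ?v (@GRing.opp ?V) ?d =>
      change (is_derive t v (fun s => @GRing.opp V s) d); isder_step
  | _ => idtac
  end.
Ltac isder := notypeclasses refine (is_derive_eq _ _); [isder_step | rewrite /=].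

(** * Primitives and global solutions of Lipschitz equations *)

Lemma is_derive_continuous {R : realType} {V : normedModType R}
    (f df : R -> V) :
  (forall t : R, is_derive t 1 f (df t)) -> continuous f.
Proof.
by move=> fE t; apply/differentiable_continuous/derivable1_diffP; exact: ex_derive.
Qed.

Lemma derive_ge0_le {R : realType} (f df : R -> R) (a b : R) :
  a <= b -> (forall t : R, is_derive t 1 f (df t)) ->
  (forall t, a <= t <= b -> 0 <= df t) -> f a <= f b.
Proof.
move=> ab fE df0.
have [|c] := @MVT_segment R f df a b ab (fun x _ => fE x).
  by apply: continuous_subspaceT; exact: is_derive_continuous fE.
rewrite in_itv/= => cab fab; rewrite -subr_ge0 fab.
by rewrite mulr_ge0 ?subr_ge0// df0.
Qed.

Lemma is_derive_reflect {R : realType} (f : R -> R) (df : R -> R) :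
  (forall t : R, is_derive t 1 f (df t)) ->
  forall t : R, is_derive t 1 (fun s => f (- s)) (- df (- t)).
Proof.
move=> fE t; have fEt := fE (- t).
have -> : - df (- t) = df (- t) * (- 1) by rewrite mulrN1.
exact: is_derive_comp1.
Qed.

(** A function vanishing at [0] whose derivative is dominated by that of
    [C * exp (K * |t|)] is itself dominated by that exponential. *)
Lemma derive_le_expR {R : realType} (C K : R) (f df : R -> R) :
  0 <= C -> 0 <= K ->
  (forall t : R, is_derive t 1 f (df t)) -> f 0 = 0 ->
  (forall t, `|df t| <= C * K * expR (K * `|t|)) ->
  forall t, `|f t| <= C * expR (K * `|t|).
Proof.
move=> C0 K0.
have side (g dg : R -> R) : (forall t : R, is_derive t 1 g (dg t)) -> g 0 = 0 ->
    (forall t, `|dg t| <= C * K * expR (K * `|t|)) ->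
    forall t, 0 <= t -> g t <= C * expR (K * t).
  move=> gE g0 dgle t t0.
  have hE (s : R) : is_derive s 1 (fun s => C * expR (K * s) - g s)
      (C * K * expR (K * s) - dg s).
    by isder; ring.
  have := derive_ge0_le t0 hE; rewrite mulr0 expR0 g0 subr0 mulr1.
  rewrite -[_ <= C * _ - _]subr_ge0 => H; rewrite -subr_ge0 (le_trans C0)// -subr_ge0.
  apply: H => s /andP[s0 _]; rewrite subr_ge0.
  have := dgle s; rewrite (ger0_norm s0); apply: le_trans; exact: ler_norm.
move=> fE f0 dfle.
have side2 (g dg : R -> R) : (forall t : R, is_derive t 1 g (dg t)) -> g 0 = 0 ->
    (forall t, `|dg t| <= C * K * expR (K * `|t|)) ->
    forall t, 0 <= t -> `|g t| <= C * expR (K * t).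
  move=> gE g0 dgle t t0; rewrite ler_norml lerNl; apply/andP.
  split; last exact: side gE _ _ _ _.
  apply: (side (fun s => - g s) (fun s => - dg s)) => //.
  - by rewrite g0 oppr0.
  - by move=> s; rewrite normrN.
move=> t; have [t0|t0] := leP 0 t.
  by rewrite (ger0_norm t0); exact: side2 fE _ _ _ _.
have -> : `|t| = - t by rewrite ltr0_norm.
rewrite -{1}(opprK t).
apply: (side2 (fun s => f (- s)) (fun s => - df (- s))) => //.
- exact: is_derive_reflect.
- by rewrite oppr0.
- by move=> s; rewrite normrN -(normrN s).
- by rewrite oppr_ge0 ltW.
Qed.

(** The lower end [-1] of the integral only serves to reach past the origin. *)
Lemma halfline_primitive {R : realType} (f : R -> R) : continuous f ->
  exists F : R -> R, forall t : R, -1 < t -> is_derive t 1 F (f t).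
Proof.
move=> cf.
pose F x := (\int[lebesgue_measure]_(t in `[-1, x]) f t)%R.
exists F => t t1.
have [||dF F'E] := @continuous_FTC1_closed R f (-1) t (t + 1) _ _ t1 (cf t).
- by rewrite ltrDl.
- apply: continuous_compact_integrable; first exact: segment_compact.
  exact: continuous_subspaceT.
- by rewrite -[f t]F'E derive1E; exact: (DeriveDef dF (erefl _)).
Qed.

Lemma is_derive_0_ball {R : realType} (h : R -> R) (T : R) :
  (forall s : R, `|s| < T -> is_derive s 1 h 0) ->
  forall s, `|s| < T -> h s = h 0.
Proof.
move=> hE x xT.
have dE (y : R) : `|y| <= `|x| -> is_derive y 1 h 0.
  by move=> yx; apply: hE; exact: le_lt_trans yx xT.
have cont (a b : R) : (forall y, y \in `[a, b]%R -> `|y| <= `|x|) ->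
    {within `[a, b], continuous h}.
  by move=> H; apply: derivable_within_continuous => y yab; case: (dE y (H y yab)).
have [x0|x0] := leP 0 x.
  have H (y : R) : y \in `[0, x]%R -> `|y| <= `|x|.
    by rewrite in_itv/= => /andP[y0 yx]; rewrite !ger0_norm.
  have [||c _] := @MVT_segment R h (fun=> 0) 0 x x0.
  - by move=> y; rewrite in_itv/= => /andP[y0 yx]; apply: dE; rewrite !ger0_norm// ltW.
  - exact: cont.
  - by rewrite mul0r => /eqP; rewrite subr_eq0 => /eqP.
have H (y : R) : y \in `[x, 0]%R -> `|y| <= `|x|.
  by rewrite in_itv/= => /andP[xy y0]; rewrite (ler0_norm y0) (ltr0_norm x0); lra.
have [|||c _] := @MVT_segment R h (fun=> 0) x 0.
- exact: ltW.
- move=> y; rewrite in_itv/= => /andP[xy y0]; apply: dE.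
  by rewrite (ltr0_norm y0) (ltr0_norm x0); lra.
- exact: cont.
- by rewrite mul0r => /eqP; rewrite subr_eq0 => /eqP.
Qed.

(** Every continuous function on the line has a primitive: one primitive on
    each side of the origin, glued where both exist. *)
Lemma continuous_primitive {R : realType} (f : R -> R) : continuous f ->
  exists F : R -> R, F 0 = 0 /\ forall t : R, is_derive t 1 F (f t).
Proof.
move=> cf.
have [F1 F1E] := halfline_primitive cf.
have [F2 F2E] : exists F : R -> R, forall t : R, t < 1 -> is_derive t 1 F (f t).
  have [|G GE] := @halfline_primitive R (fun t => - f (- t)).
    move=> x; apply: continuousN; apply: (@continuous_comp _ _ _ -%R f); last exact: cf.
    exact: opp_continuous.
  exists (fun t => G (- t)) => t t1.
  have GEt : is_derive (- t) 1 G (- f t) by have := GE (- t); rewrite opprK ltrN2; exact.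
  have -> : f t = - f t * (- 1) by rewrite mulrN1 opprK.
  exact: is_derive_comp1.
have glue (x : R) : -1 < x < 1 -> F1 x - F1 0 = F2 x - F2 0.
  move=> x11.
  have dE (y : R) : `|y| < 1 -> is_derive y 1 (fun s => F1 s - F2 s) 0.
    rewrite ltr_norml => /andP[y1 y2]; have := F1E _ y1; have := F2E _ y2 => ? ?.
    by isder; rewrite subrr.
  have x1 : `|x| < 1 by rewrite ltr_norml.
  by have := is_derive_0_ball dE x1; lra.
pose F x := if x < 0 then F2 x - F2 0 else F1 x - F1 0.
have FE1 (x : R) : -1 < x -> F x = F1 x - F1 0.
  by move=> x1; rewrite /F; case: ifPn => // x0; rewrite glue// x1/=; lra.
have FE2 (x : R) : x < 1 -> F x = F2 x - F2 0.
  move=> x1; rewrite /F; case: ifPn => //; rewrite -leNgt => x0.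
  by rewrite glue// x1 andbT; lra.
exists F; split; first by rewrite /F ltxx subrr.
move=> t; have [t0|t0] := ltP t 0.
  apply: (@near_eq_is_derive _ _ _ (fun s => F2 s - F2 0)) => //.
  - near=> y; rewrite FE2//; near: y; apply: lt_nbhsl; lra.
  - by have := F2E t (lt_trans t0 ltr01) => ?; isder; rewrite addr0.
apply: (@near_eq_is_derive _ _ _ (fun s => F1 s - F1 0)) => //.
- near=> y; rewrite FE1//; near: y; apply: lt_nbhsr; lra.
- have t1 : -1 < t by lra.
  by have := F1E t t1 => ?; isder; rewrite addr0.
Unshelve. all: by end_near. Qed.

Lemma geometric_limit {R : realType} (C : R) (u : nat -> R) :
  (forall k, `|u k.+1 - u k| <= C * 2^-1 ^+ k) ->
  exists l, forall k, `|l - u k| <= 2 * C * 2^-1 ^+ k.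
Proof.
move=> uC.
have C0 : 0 <= C.
  by have := le_trans (normr_ge0 _) (uC 0%N); rewrite expr0 mulr1.
have ucvg : cvgn u.
  have -> : u = fun n => u 0%N + series (telescope u) n.
    by apply/funext => n; rewrite -eq_sum_telescope.
  apply: is_cvgD; first exact: is_cvg_cst.
  apply: normed_cvg; apply: (@series_le_cvg _ _ (geometric C 2^-1)).
  - by move=> n; exact: normr_ge0.
  - by move=> n; rewrite /= mulr_ge0// exprn_ge0// invr_ge0.
  - by move=> n; exact: uC.
  - by apply: is_cvg_geometric_series; rewrite ger0_norm ?invr_ge0// invf_lt1// ltr1n.
exists (limn u) => k.
have step m : `|u (k + m)%N - u k| <= 2 * C * 2^-1 ^+ k * (1 - 2^-1 ^+ m).
  elim: m => [|m IH]; first by rewrite addn0 !subrr normr0 mulr0.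
  rewrite addnS -(subrK (u (k + m)%N) (u _)) -addrA.
  apply: le_trans (ler_normD _ _) _.
  apply: le_trans (lerD (uC _) IH) _.
  by rewrite exprD exprS le_eqVlt; apply/orP; left; apply/eqP; field.
apply/ler_addgt0Pr => e e0.
have /cvgrPdist_le/(_ e e0)[N _ HN] := ucvg.
have := HN (k + N)%N (leq_addl _ _) => /= H.
rewrite -(subrK (u (k + N)%N) (limn u)) -addrA addrC.
apply: le_trans (ler_normD _ _) _.
apply: lerD; last exact: H.
apply: le_trans (step N) _.
by rewrite ler_piMr ?mulr_ge0// ?exprn_ge0 ?invr_ge0// gerBl exprn_ge0// invr_ge0.
Qed.

Lemma mx_entry_norm {R : realType} m n (M : 'M[R]_(m, n)) i j : `|M i j| <= `|M|.
Proof.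
rewrite [leRHS]/Num.Def.normr/= mx_normrE.
exact: (le_bigmax _ (fun ij => `|M ij.1 ij.2|) (i, j)).
Qed.

Lemma mx_norm_le {R : realType} m n (M : 'M[R]_(m, n)) (C : R) :
  0 <= C -> (forall i j, `|M i j| <= C) -> `|M| <= C.
Proof.
by move=> C0 MC; rewrite /Num.Def.normr/= mx_normrE (bigmax_le _ C0).
Qed.

Lemma is_derive_mx {R : realType} m n (x : R -> 'M[R]_(m, n))
    (dx : 'M[R]_(m, n)) (t : R) :
  is_derive t 1 x dx <-> forall i j, is_derive t 1 (fun s => x s i j) (dx i j).
Proof.
split=> [[dxt <-] i j|H].
  apply: DeriveDef; first exact: (derivable_mxP _ _ _).1.
  by rewrite derive_mx// mxE.
have dxt : derivable x t 1 by apply/derivable_mxP => i j; case: (H i j).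
apply: DeriveDef => //; rewrite derive_mx//; apply/matrixP => i j.
by rewrite mxE; case: (H i j).
Qed.

Lemma continuous_mx {R : realType} m n (x : R -> 'M[R]_(m, n)) :
  continuous x <-> forall i j, continuous (fun s => x s i j).
Proof.
split=> [cx i j t|cx t].
  apply: (@continuous_comp _ _ _ x (fun M : 'M[R]_(m, n) => M i j)); first exact: cx.
  exact: coord_continuous.
apply/cvgrPdist_le => e e0; near=> s.
apply: mx_norm_le => [|i j]; first exact: ltW.
rewrite !mxE; move: (i) (j); near: s.
apply: filter_forall => i'; apply: filter_forall => j'.
by have /cvgrPdist_le := cx i' j' t; apply.
Unshelve. all: by end_near. Qed.

Lemma continuous_primitive_mx {R : realType} m n (g : R -> 'M[R]_(m, n)) :
  continuous g ->
  exists G : R -> 'M[R]_(m, n), G 0 = 0 /\ forall t : R, is_derive t 1 G (g t).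
Proof.
move=> /continuous_mx cg.
have /choice[G GE] : forall ij : 'I_m * 'I_n, exists F : R -> R,
    F 0 = 0 /\ forall t : R, is_derive t 1 F (g t ij.1 ij.2).
  by move=> ij; exact: continuous_primitive.
exists (fun t => \matrix_(i, j) G (i, j) t); split.
  by apply/matrixP => i j; rewrite !mxE (GE (i, j)).1.
move=> t; apply/is_derive_mx => i j.
have := (GE (i, j)).2 t; congr (is_derive _ _ _ _).
by apply/funext => s; rewrite mxE.
Qed.

Lemma derive_le_expR_mx {R : realType} m n (C K : R) (f df : R -> 'M[R]_(m, n)) :
  0 <= C -> 0 <= K ->
  (forall t : R, is_derive t 1 f (df t)) -> f 0 = 0 ->
  (forall t, `|df t| <= C * K * expR (K * `|t|)) ->
  forall t, `|f t| <= C * expR (K * `|t|).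
Proof.
move=> C0 K0 fE f0 dfle t; apply: mx_norm_le => [|i j].
  by rewrite mulr_ge0// expR_ge0.
apply: (@derive_le_expR R C K (fun s => f s i j) (fun s => df s i j)) => //.
- by move=> s; have /is_derive_mx := fE s; apply.
- by rewrite f0 mxE.
- by move=> s; apply: le_trans (dfle s); exact: mx_entry_norm.
Qed.

(** Global existence for [x' = F x] with [F] globally Lipschitz.  Successive
    Picard iterates differ by at most [C * 2 ^ - k * exp (2 * L * |t|)], the
    exponential weight making the integral operator a contraction of ratio
    one half on the whole line. *)
Lemma picard_lindelof {R : realType} m n (F : 'M[R]_(m, n) -> 'M[R]_(m, n))
    (L : R) (x0 : 'M[R]_(m, n)) :
  0 < L -> (forall x y, `|F x - F y| <= L * `|x - y|) ->
  exists x : R -> 'M[R]_(m, n),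
    x 0 = x0 /\ forall t : R, is_derive t 1 x (F (x t)).
Proof.
move=> L0 FL.
have /choice[prim primP] : forall g : R -> 'M[R]_(m, n), exists G, continuous g ->
    G 0 = 0 /\ forall t : R, is_derive t 1 G (g t).
  move=> g; have [cg|ncg] := pselect (continuous g); last by exists g => /ncg.
  by have [G GE] := continuous_primitive_mx cg; exists G.
have cF (x : R -> 'M[R]_(m, n)) : continuous x -> continuous (F \o x).
  move=> cx t; apply/cvgrPdist_lt => e e0; near=> s.
  apply: le_lt_trans (FL _ _) _; rewrite -ltr_pdivlMl//.
  by near: s; have /cvgrPdist_lt := cx t; apply; rewrite mulr_gt0// invr_gt0.
pose T (x : R -> 'M[R]_(m, n)) (t : R) := x0 + prim (F \o x) t.
have TE x : continuous x -> T x 0 = x0 /\ forall t : R, is_derive t 1 (T x) (F (x t)).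
  move=> /cF/primP[p0 pE]; split; first by rewrite /T p0 addr0.
  move=> t; have := pE t => ?.
  have -> : F (x t) = 0 + F (x t) by rewrite add0r.
  exact: is_deriveD.
have Tc x : continuous x -> continuous (T x).
  by move=> /TE[_ h]; exact: is_derive_continuous h.
pose X k := iter k T (fun=> x0).
have Xc k : continuous (X k).
  by elim: k => [|k IH]; [exact: cst_continuous|exact: Tc].
pose K := 2 * L.
have K0 : 0 < K by rewrite /K mulr_gt0.
have [C [C0 CK]] : exists C : R, 0 <= C /\ C * K = `|F x0|.
  exists (`|F x0| / K); rewrite divfK ?gt_eqF//; split => //.
  by rewrite divr_ge0// ltW.
(* one application of [T] halves the weighted distance *)
have contract D x y : 0 <= D -> continuous x -> continuous y ->
    (forall t, `|x t - y t| <= D * expR (K * `|t|)) ->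
    forall t, `|T x t - T y t| <= D / 2 * expR (K * `|t|).
  move=> D0 cx cy xyD.
  apply: (@derive_le_expR_mx R _ _ _ _ _ (fun t => F (x t) - F (y t))).
  - by rewrite divr_ge0.
  - exact: ltW.
  - by move=> t; have := (TE _ cx).2 t; have := (TE _ cy).2 t => ? ?; exact: is_deriveB.
  - by rewrite (TE _ cx).1 (TE _ cy).1 subrr.
  - move=> t; apply: le_trans (FL _ _) _.
    have -> : D / 2 * K * expR (K * `|t|) = L * (D * expR (K * `|t|)).
      by rewrite /K; field.
    by rewrite ler_pM2l.
have XE k t : `|X k.+1 t - X k t| <= C * 2^-1 ^+ k * expR (K * `|t|).
  elim: k t => [|k IH] t; last first.
    have := contract _ _ _ _ (Xc k.+1) (Xc k) IH t; rewrite exprSr mulrA; apply.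
    by rewrite mulr_ge0// exprn_ge0// invr_ge0.
  rewrite expr0 mulr1.
  apply: (@derive_le_expR_mx R _ _ _ _ (fun t => X 1%N t - X 0%N t)
            (fun t => F x0)) => //.
  - exact: ltW.
  - move=> s; have := (TE _ (Xc 0%N)).2 s => ?.
    have -> : F x0 = F x0 - 0 by rewrite subr0.
    exact: is_deriveB.
  - by rewrite /= (TE _ (Xc 0%N)).1 subrr.
  - move=> s; rewrite CK.
    by rewrite ler_peMr// -expR0 ler_expR mulr_ge0// ltW.
have /choice[y yE] : forall t, exists l : 'M[R]_(m, n),
    forall k, `|l - X k t| <= 2 * C * 2^-1 ^+ k * expR (K * `|t|).
  move=> t.
  (* the limit exists entrywise, with the same rate *)
  have /choice[l lE] : forall ij : 'I_m * 'I_n, exists l : R,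
      forall k, `|l - X k t ij.1 ij.2| <= 2 * (C * expR (K * `|t|)) * 2^-1 ^+ k.
    move=> [i j]; apply: (@geometric_limit R _ (fun k => X k t i j)) => k.
    rewrite mulrAC; apply: le_trans (XE k t).
    by apply: le_trans (mx_entry_norm _ i j); rewrite !mxE.
  exists (\matrix_(i, j) l (i, j)) => k; apply: mx_norm_le => [|i j].
    by rewrite !mulr_ge0 ?expR_ge0 ?exprn_ge0 ?invr_ge0//.
  by rewrite !mxE (le_trans (lE (i, j) k))// mulrA mulrAC.
have half0 (B e : R) : 0 <= B -> 0 < e -> exists k, B * 2^-1 ^+ k < e.
  move=> B0 e0.
  have /cvgrPdist_lt/(_ e e0)[N _ HN] : geometric B 2^-1 @ \oo --> (0 : R).
    by apply: cvg_geometric; rewrite ger0_norm ?invr_ge0// invf_lt1// ltr1n.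
  exists N; have := HN N (leqnn N); rewrite /= sub0r normrN ger0_norm//.
  by rewrite mulr_ge0// exprn_ge0// invr_ge0.
have yc : continuous y.
  move=> t; apply/cvgrPdist_lt => e e0.
  have [||k Bk] := half0 (2 * C * expR (K * (`|t| + 1))) (e / 3).
  - by rewrite !mulr_ge0// expR_ge0.
  - by rewrite divr_gt0.
  have close s : `|s| <= `|t| + 1 -> `|y s - X k s| < e / 3.
    move=> st; apply: le_lt_trans (yE s k) _; apply: le_lt_trans Bk.
    rewrite mulrAC ler_wpM2r ?exprn_ge0 ?invr_ge0//.
    by rewrite ler_wpM2l ?mulr_ge0// ler_expR ler_pM2l.
  near=> s.
  have s1 : `|s| <= `|t| + 1.
    have : `|t - s| < 1 by near: s; exists 1 => //=.
    by have := ler_normB t (t - s); rewrite subKr; lra.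
  have t1 : `|t| <= `|t| + 1 by lra.
  have Xts : `|X k t - X k s| < e / 3.
    by near: s; have /cvgrPdist_lt := Xc k t; apply; rewrite divr_gt0.
  have := close _ s1; have := close _ t1.
  have -> : y t - y s = (y t - X k t) + (X k t - X k s) + (X k s - y s).
    by rewrite !subrKA.
  have := ler_normD ((y t - X k t) + (X k t - X k s)) (X k s - y s).
  have := ler_normD (y t - X k t) (X k t - X k s).
  rewrite (distrC (X k s)); lra.
have Ty : T y = y.
  apply/funext => t; apply/eqP; rewrite -subr_eq0 -normr_le0.
  apply/ler_addgt0Pr => e e0; rewrite add0r.
  have [||k Bk] := half0 (2 * C * expR (K * `|t|)) e.
  - by rewrite !mulr_ge0// expR_ge0.
  - exact: e0.
  have C2 : 0 <= 2 * C * 2^-1 ^+ k by rewrite !mulr_ge0// exprn_ge0// invr_ge0.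
  have := contract _ _ _ C2 yc (Xc k) (yE^~ k) t.
  have := yE t k.+1; rewrite distrC exprSr.
  have := ler_normD (T y t - X k.+1 t) (X k.+1 t - y t); rewrite subrKA.
  rewrite -/(X k.+1); lra.
exists y; split; first by rewrite -Ty; exact: (TE _ yc).1.
by move=> t; rewrite -{1}Ty; exact: (TE _ yc).2.
Unshelve. all: by end_near. Qed.

(** * Uniqueness and Lipschitz estimates *)

(** Gronwall: [h * exp (- C * t)] is nonincreasing for [t >= 0]; negative times
    follow by reflection. *)
Lemma gronwall_zero {R : realType} (h dh : R -> R) :
  (forall t : R, is_derive t 1 h (dh t)) -> (forall t, 0 <= h t) -> h 0 = 0 ->
  (forall T, exists C, forall t, `|t| <= T -> `|dh t| <= C * h t) ->
  forall t, h t = 0.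
Proof.
have side (g dg : R -> R) : (forall t : R, is_derive t 1 g (dg t)) ->
    (forall t, 0 <= g t) -> g 0 = 0 ->
    (forall T, exists C, forall t, `|t| <= T -> `|dg t| <= C * g t) ->
    forall t, 0 <= t -> g t = 0.
  move=> gE g0 g00 gC t t0; have [C HC] := gC t.
  have eE (s : R) : is_derive s 1 (fun s => - (g s * expR (- (C * s))))
      ((C * g s - dg s) * expR (- (C * s))).
    by isder; ring.
  have := derive_ge0_le t0 eE; rewrite g00 mul0r oppr0 oppr_ge0 => H.
  apply/eqP; rewrite eq_le g0 andbT -(pmulr_lle0 _ (expR_gt0 (- (C * t)))).
  apply: H => s /andP[s0 st]; rewrite mulr_ge0 ?expR_ge0// subr_ge0.
  by apply: le_trans (ler_norm _) (HC _ _); rewrite ger0_norm.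
move=> hE h0 h00 hC t; have [t0|t0] := leP 0 t; first exact: side hE _ _ _ _ _.
rewrite -(opprK t); apply: (side (fun s => h (- s)) (fun s => - dh (- s))) => //.
- exact: is_derive_reflect.
- by rewrite oppr0.
- move=> T; have [C HC] := hC T; exists C => s sT.
  by rewrite normrN HC// normrN.
- by rewrite oppr_ge0 ltW.
Qed.

(** The same for finitely many functions, applied to the sum of their
    squares. *)
Lemma gronwall_family_zero {R : realType} (I : finType) (f df : I -> R -> R) :
  (forall i (t : R), is_derive t 1 (f i) (df i t)) -> (forall i, f i 0 = 0) ->
  (forall T i, exists C, forall t, `|t| <= T ->
     `|df i t| <= C * \sum_j `|f j t|) ->
  forall i t, f i t = 0.
Proof.
move=> fE f0 fC.
pose h (t : R) := \sum_i f i t ^+ 2.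
have hE (t : R) : is_derive t 1 h (\sum_i (2 * f i t * df i t)).
  have H i : is_derive t 1 (fun s => f i s ^+ 2) (2 * f i t * df i t).
    by have := fE i t => fit; isder; rewrite expr1.
  have -> : h = \sum_i (fun s => f i s ^+ 2).
    by apply/funext => s; rewrite /h fct_sumE.
  elim/big_ind2 : _ => [|? ? ? ? ? ?|i _]; last exact: H.
  - exact: is_derive_cst.
  - exact: is_deriveD.
have h0 t : 0 <= h t by apply: sumr_ge0 => i _; exact: sqr_ge0.
suff hz t : h t = 0.
  move=> i t; have /eqP := hz t; rewrite psumr_eq0; last by move=> j _; exact: sqr_ge0.
  by move=> /allP/(_ i (mem_index_enum _)); rewrite sqrf_eq0 => /eqP.
apply: (gronwall_zero hE h0) => [|T].
  by rewrite /h big1// => i _; rewrite f0 expr0n.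
have /choice[C HC] := fC T.
pose N : R := (\sum_(j : I) 1).
clear t; exists (\sum_i 2 * (`|C i| * (N + 1))) => t tT.
apply: le_trans (ler_norm_sum _ _ _) _; rewrite mulr_suml; apply: ler_sum => i _.
have N0 : 0 <= N by apply: sumr_ge0.
have fih j : f j t ^+ 2 <= h t.
  by rewrite /h (bigD1 j)//= lerDl sumr_ge0// => k _; exact: sqr_ge0.
rewrite !normrM ger0_norm// -!mulrA ler_pM2l//.
apply: (@le_trans _ _ (`|f i t| * (`|C i| * \sum_j `|f j t|))).
  rewrite ler_wpM2l//; apply: le_trans (HC i t tT) _.
  by rewrite ler_wpM2r ?ler_norm// sumr_ge0.
rewrite mulrCA ler_wpM2l// mulr_sumr.
(* [|x| * |y| <= x ^+ 2 + y ^+ 2], and each square is at most [h] *)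
apply: (@le_trans _ _ (\sum_j (h t + f j t ^+ 2))).
  apply: ler_sum => j _.
  have := fih i.
  rewrite -(real_normK (num_real (f i t))) -(real_normK (num_real (f j t))).
  have := sqr_ge0 (`|f i t| - `|f j t|); rewrite sqrrB.
  have := sqr_ge0 `|f i t|; have := sqr_ge0 `|f j t|; lra.
rewrite big_split/= -/(h t) mulrDl mul1r lerD2r /N mulr_suml.
by apply: ler_sum => j _; rewrite mul1r.
Qed.

(** [close_on D d f g]: on [D], the functions [f] and [g] are bounded and their
    difference is controlled by a multiple of [d].  Stability of this relation
    under the algebraic operations gives every Lipschitz estimate below. *)
Definition close_on {R : realType} {T : Type} (D : set T) (d f g : T -> R) :=
  exists C, forall t, D t ->
    [/\ `|f t - g t| <= C * d t, `|f t| <= C & `|g t| <= C].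

Section close_on.
Context {R : realType} {T : Type} (D : set T) (d : T -> R).
Hypothesis d0 : forall t, 0 <= d t.
Implicit Types f g : T -> R.

Lemma close_on_intro f g :
  (exists C, forall t, D t -> `|f t - g t| <= C * d t) ->
  (exists C, forall t, D t -> `|f t| <= C) ->
  (exists C, forall t, D t -> `|g t| <= C) -> close_on D d f g.
Proof.
move=> [C1 H1] [C2 H2] [C3 H3]; exists (`|C1| + `|C2| + `|C3|) => t Dt.
have := H1 t Dt; have := H2 t Dt; have := H3 t Dt.
have := ler_norm C1; have := ler_norm C2; have := ler_norm C3.
have := normr_ge0 C1; have := normr_ge0 C2; have := normr_ge0 C3.
move=> n3 n2 n1 c3 c2 c1 h3 h2 h1; split; [|lra|lra].
by apply: le_trans h1 _; rewrite ler_wpM2r//; lra.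
Qed.

Lemma close_on_cst (c : R) : close_on D d (fun=> c) (fun=> c).
Proof.
exists `|c| => t _; split => //.
by rewrite subrr normr0 mulr_ge0.
Qed.

Lemma close_onD f g f' g' : close_on D d f f' -> close_on D d g g' ->
  close_on D d (fun t => f t + g t) (fun t => f' t + g' t).
Proof.
move=> [C1 H1] [C2 H2]; exists (C1 + C2) => t Dt.
have [a1 b1 c1] := H1 t Dt; have [a2 b2 c2] := H2 t Dt.
split; [|exact: le_trans (ler_normD _ _) (lerD _ _)..].
rewrite opprD addrACA mulrDl; exact: le_trans (ler_normD _ _) (lerD _ _).
Qed.

Lemma close_onN f f' : close_on D d f f' ->
  close_on D d (fun t => - f t) (fun t => - f' t).
Proof.
move=> [C H]; exists C => t Dt; have [a b c] := H t Dt.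
by rewrite -opprD !normrN.
Qed.

Lemma close_onM f g f' g' : close_on D d f f' -> close_on D d g g' ->
  close_on D d (fun t => f t * g t) (fun t => f' t * g' t).
Proof.
move=> [C1 H1] [C2 H2]; apply: close_on_intro.
- exists (C1 * C2 + C1 * C2) => t Dt.
  have [a1 b1 c1] := H1 t Dt; have [a2 b2 c2] := H2 t Dt.
  have -> : f t * g t - f' t * g' t = f t * (g t - g' t) + (f t - f' t) * g' t by ring.
  apply: le_trans (ler_normD _ _) _; rewrite !normrM mulrDl; apply: lerD.
    by rewrite -mulrA; apply: ler_pM.
  by rewrite mulrAC; apply: ler_pM.
- exists (C1 * C2) => t Dt; have [_ b1 _] := H1 t Dt; have [_ b2 _] := H2 t Dt.
  by rewrite normrM ler_pM.
- exists (C1 * C2) => t Dt; have [_ _ b1] := H1 t Dt; have [_ _ b2] := H2 t Dt.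
  by rewrite normrM ler_pM.
Qed.

Lemma close_onX n f f' : close_on D d f f' ->
  close_on D d (fun t => f t ^+ n) (fun t => f' t ^+ n).
Proof.
move=> ff'; elim: n => [|n IH].
  by move=> *; exact: (close_on_cst 1).
have E (h : T -> R) : (fun t => h t ^+ n.+1) = (fun t => h t * h t ^+ n).
  by apply/funext => t; rewrite exprS.
rewrite !E; exact: close_onM.
Qed.

Lemma close_onV (c : R) f f' : 0 < c -> (forall t, D t -> c <= f t) ->
  (forall t, D t -> c <= f' t) -> close_on D d f f' ->
  close_on D d (fun t => (f t)^-1) (fun t => (f' t)^-1).
Proof.
move=> c0 fc f'c [C H].
have Vle x : c <= x -> `|x^-1| <= c^-1.
  move=> cx; have x0 := lt_le_trans c0 cx.
  by rewrite ger0_norm ?lef_pV2// invr_ge0 ltW.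
apply: close_on_intro; [|by exists c^-1 => t Dt; apply: Vle; auto..].
exists (c^-1 * c^-1 * C) => t Dt; have [a _ _] := H t Dt.
have ft0 := lt_le_trans c0 (fc t Dt); have f't0 := lt_le_trans c0 (f'c t Dt).
have -> : (f t)^-1 - (f' t)^-1 = (f t)^-1 * (f' t)^-1 * - (f t - f' t).
  by field; rewrite !gt_eqF.
rewrite !normrM normrN.
have v1 := Vle _ (fc t Dt); have v2 := Vle _ (f'c t Dt).
have v12 : `|(f t)^-1| * `|(f' t)^-1| <= c^-1 * c^-1 by apply: ler_pM.
by rewrite -(mulrA _ C); apply: ler_pM => //; rewrite mulr_ge0.
Qed.

End close_on.

(** Derives [close_on] for polynomial expressions from hypotheses on their
    atoms. *)
Ltac close_step :=
  match goal with
  | H : close_on _ _ ?f ?g |- close_on _ _ ?f ?g => exact H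
  | |- close_on _ _ (fun _ => ?c) (fun _ => ?c) => apply: close_on_cst
  | |- close_on _ _ (fun t => @?f t + @?g t) _ => apply: close_onD; close_step
  | |- close_on _ _ (fun t => - @?f t) _ => apply: close_onN; close_step
  | |- close_on _ _ (fun t => @?f t * @?g t) _ => apply: close_onM; close_step
  | |- close_on _ _ (fun t => @?f t ^+ _) _ => apply: close_onX; close_step
  | _ => idtac
  end.

(** * Compactness and continuation in time *)

Lemma continuous_bounded_on {R : realType} (f : R -> R) (T : R) :
  continuous f -> exists C, forall t, `|t| <= T -> `|f t| <= C.
Proof.
move=> cf; have [T0|T0] := leP 0 T; last first.
  by exists 0 => t tT; have := normr_ge0 t; lra.
have [||c _ H] := @EVT_max R (fun t => `|f t|) (- T) T.
- lra.
- apply: continuous_subspaceT => t; apply: continuous_comp; first exact: cf.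
  exact: norm_continuous.
- by exists `|f c| => t; rewrite ler_norml => tT; apply: H; rewrite in_itv.
Qed.

Lemma continuous_positive_on {R : realType} (f : R -> R) (T : R) :
  continuous f -> (forall t, 0 < f t) ->
  exists2 c, 0 < c & forall t, `|t| <= T -> c <= f t.
Proof.
move=> cf f0; have [T0|T0] := leP 0 T; last first.
  by exists 1 => // t tT; have := normr_ge0 t; lra.
have [||c _ H] := @EVT_min R f (- T) T; [lra|exact: continuous_subspaceT|].
by exists (f c) => // t; rewrite ler_norml => tT; apply: H; rewrite in_itv.
Qed.

Lemma continuous_ge0_closed {R : realType} (f : R -> R) (T : R) :
  continuous f -> 0 < T -> (forall s, `|s| < T -> 0 <= f s) ->
  forall s, `|s| <= T -> 0 <= f s.
Proof.
move=> cf T0 H s sT.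
have lim1 : (fun e : R => f ((1 - e) * s)) e @[e --> 0^'+] --> f s.
  apply: cvg_at_right_filter.
  have -> : f s = f ((1 - 0) * s) by rewrite subr0 mul1r.
  apply: (@continuous_comp _ _ _ (fun e : R => (1 - e) * s) f); last exact: cf.
  apply: (@is_derive_continuous _ _ (fun e : R => (1 - e) * s) (fun=> - s)) => t.
  by isder; ring.
apply: (cvgr_to_ge lim1); near=> e; apply: H.
have e1 : e < 1 by near: e; exact: nbhs_right_lt.
have e0 : 0 < e by near: e; exact: nbhs_right_gt.
rewrite normrM ger0_norm; last by lra.
have [->|s0] := eqVneq s 0; first by rewrite normr0 mulr0.
by apply: lt_le_trans sT; rewrite gtr_pMl ?normr_gt0//; lra.
Unshelve. all: by end_near. Qed.

(** Continuation principle: suppose that an open condition, whenever it holds on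
    an open interval centred at [0], also holds at the end points.  Then it
    always holds.  The case [T = 0], where the interval is empty, says that it
    holds at time [0]. *)
Lemma continuation {R : realType} (g : R -> R) : continuous g ->
  (forall T, 0 <= T -> (forall s, `|s| < T -> 0 < g s) ->
     forall s, `|s| <= T -> 0 < g s) ->
  forall t, 0 < g t.
Proof.
move=> cg H t0; rewrite ltNge; apply/negP => gt0.
pose S := [set x | exists2 t, x = `|t| & g t <= 0].
have S0 : S !=set0 by exists `|t0|; exists t0.
have Slb : has_lbound S by exists 0 => _ [t -> _]; exact: normr_ge0.
have Sinf : has_inf S by [].
(* the first time, in absolute value, at which positivity fails *)
pose T := inf S.
have T0 : 0 <= T by apply: lb_le_inf => // _ [t -> _]; exact: normr_ge0.
have gT s : `|s| < T -> 0 < g s.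
  move=> sT; rewrite ltNge; apply/negP => gs.
  by move: sT; rewrite ltNge => /negP; apply; apply: ge_inf => //; exists s.
have gT' := H T T0 gT.
have near_pos s : `|s| <= T ->
    \forall e \near (0:R)^'+, forall r, `|r - s| < e -> 0 < g r.
  move=> sT; have /cvgrPdist_lt/(_ _ (gT' s sT)) := cg s.
  move=> [e /= e0 He]; near=> d => r rs.
  have : `|g s - g r| < g s.
    by apply: He; rewrite /= distrC; apply: lt_trans rs _; near: d; exact: nbhs_right_lt.
  by rewrite ltr_norml; lra.
have [e [e0 He]] : exists e : R, 0 < e /\ forall r s, `|s| = T -> `|r - s| < e -> 0 < g r.
  have HT : `|T| <= T by rewrite ger0_norm.
  have HNT : `|- T| <= T by rewrite normrN.
  near (0:R)^'+ => e; exists e; split; first by near: e; exact: nbhs_right_gt.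
  move=> r s sT; have [sE|sE] : s = T \/ s = - T.
    by have [s0|s0] := leP 0 s; move: sT; [rewrite ger0_norm//|rewrite ltr0_norm//]; lra.
  - by rewrite sE; move: r; near: e; exact: near_pos.
  - by rewrite sE; move: r; near: e; exact: near_pos.
have [x [t xE gt] xT] := inf_adherent e0 Sinf.
have Tt : T <= `|t| by apply: ge_inf => //; exists t.
suff : 0 < g t by rewrite ltNge gt.
have [t1|t1] := leP 0 t.
- apply: (He t T); first by rewrite ger0_norm.
  by move: Tt xT; rewrite xE ger0_norm// => Tt xT; rewrite ger0_norm; lra.
- apply: (He t (- T)); first by rewrite normrN ger0_norm.
  by move: Tt xT; rewrite xE ltr0_norm// => Tt xT; rewrite ler0_norm; lra.
Unshelve. all: by end_near. Qed.

(** * The radial motion *)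

(** The right-hand sides of the equations for [q1] and [xi1], and the
    conserved energy, as functions of the radius [q] and its momentum [p].  The
    constants [b] and [c] stand for the momenta [xi2] and [xi3]. *)
Definition radial_velocity {R : realType} (q p : R) : R :=
  (2 + q ^+ 2) * p / (2 * (1 + q ^+ 2)).

Definition radial_force {R : realType} (kappa b c q p : R) : R :=
  (p ^+ 2 / (2 * (1 + q ^+ 2) ^+ 2) + b ^+ 2 / q ^+ 4
   + c ^+ 2 / (2 + q ^+ 2) ^+ 2 - 2 * kappa) * q.

Definition radial_energy {R : realType} (kappa b c q p : R) : R :=
  p ^+ 2 / 4 * (1 + (1 + q ^+ 2)^-1) + b ^+ 2 / 2 * (q ^+ 2)^-1
  + c ^+ 2 / 2 * (2 + q ^+ 2)^-1 + kappa * q ^+ 2.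

Lemma add_sqr_neq0 {R : realType} (c q : R) : 0 < c -> c + q ^+ 2 != 0.
Proof. by move=> c0; rewrite gt_eqF// ltr_pwDl// sqr_ge0. Qed.

Lemma radial_energy_conserved {R : realType} (kappa b c : R) (q p : R -> R) (t : R) :
  q t != 0 ->
  is_derive t 1 q (radial_velocity (q t) (p t)) ->
  is_derive t 1 p (radial_force kappa b c (q t) (p t)) ->
  is_derive t 1 (fun s => radial_energy kappa b c (q s) (p s)) 0.
Proof.
move=> q0 qE pE; rewrite /radial_energy.
have q1 := add_sqr_neq0 (q t) (ltr01 : 0 < (1 : R)).
have q2 := add_sqr_neq0 (q t) (ltr0Sn R 1).
isder => //; first by rewrite sqrf_eq0.
rewrite /radial_velocity /radial_force; field.
by rewrite q0 q1 q2.
Qed.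

(** All terms of the energy are nonnegative, so each is at most the whole. *)
Lemma radial_energy_bounds {R : realType} (kappa b c q p : R) :
  0 <= kappa -> 0 < q ->
  p ^+ 2 <= 4 * radial_energy kappa b c q p /\
  b ^+ 2 <= 2 * radial_energy kappa b c q p * q ^+ 2.
Proof.
move=> k0 q0; have q20 : 0 < q ^+ 2 by rewrite exprn_gt0.
have i1 : 0 <= p ^+ 2 / 4 * (1 + q ^+ 2)^-1.
  by rewrite mulr_ge0 ?invr_ge0 ?divr_ge0 ?sqr_ge0// addr_ge0// ltW.
have i2 : 0 <= b ^+ 2 / 2 * (q ^+ 2)^-1.
  by rewrite mulr_ge0 ?invr_ge0 ?divr_ge0 ?sqr_ge0.
have i3 : 0 <= c ^+ 2 / 2 * (2 + q ^+ 2)^-1.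
  by rewrite mulr_ge0 ?invr_ge0 ?divr_ge0 ?sqr_ge0// addr_ge0// ltW.
have i4 : 0 <= kappa * q ^+ 2 by rewrite mulr_ge0 ?sqr_ge0.
have i5 := sqr_ge0 p.
rewrite /radial_energy (mulrDr (p ^+ 2 / 4)) mulr1; split; first lra.
rewrite [leLHS](_ : _ = 2 * (b ^+ 2 / 2 * (q ^+ 2)^-1) * q ^+ 2); last first.
  by field; rewrite gt_eqF.
rewrite ler_pM2r// ler_pM2l//; lra.
Qed.

Lemma maxr_dist {R : realType} (a x y : R) :
  `|Num.max a x - Num.max a y| <= `|x - y|.
Proof.
rewrite ler_norml.
have := ler_norm (x - y); have := ler_norm (- (x - y)); rewrite normrN.
by case: (leP a x) => ax; case: (leP a y) => ay; move=> *; apply/andP; split; lra.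
Qed.

Lemma minr_dist {R : realType} (a x y : R) :
  `|Num.min a x - Num.min a y| <= `|x - y|.
Proof.
rewrite ler_norml.
have := ler_norm (x - y); have := ler_norm (- (x - y)); rewrite normrN.
by case: (leP a x) => ax; case: (leP a y) => ay; move=> *; apply/andP; split; lra.
Qed.

Lemma ge1_add_mul_sqr {R : realType} (c x : R) : 0 <= c -> 1 <= 1 + c * x ^+ 2.
Proof. by move=> c0; rewrite lerDl mulr_ge0// sqr_ge0. Qed.

(** The radial field, frozen below the radius [a] and beyond the momentum [P],
    is globally Lipschitz. *)
Lemma radial_field_lipschitz {R : realType} (kappa b c a P : R) :
  0 <= kappa -> 0 < a -> 0 <= P ->
  let u (y : 'cV[R]_2) := Num.max a (y 0 0) in
  let v (y : 'cV[R]_2) := Num.max (- P) (Num.min P (y 1 0)) in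
  exists2 L, 0 < L & forall x y : 'cV[R]_2,
    `|radial_velocity (u x) (v x) - radial_velocity (u y) (v y)| <= L * `|x - y| /\
    `|radial_force kappa b c (u x) (v x) - radial_force kappa b c (u y) (v y)|
      <= L * `|x - y|.
Proof.
move=> k0 a0 P0 u v.
have ua x : a <= u x by rewrite /u le_max lexx.
have u0 x : 0 < u x by exact: lt_le_trans (ua x).
pose D : set ('cV[R]_2 * 'cV[R]_2) := setT.
pose d (z : 'cV[R]_2 * 'cV[R]_2) := `|z.1 - z.2|.
have d0 z : 0 <= d z by exact: normr_ge0.
have u_lip x y : `|u x - u y| <= `|x - y|.
  apply: le_trans (maxr_dist _ _ _) _.
  by apply: le_trans (mx_entry_norm _ 0 0); rewrite !mxE.
have vC : close_on D d (fun z => v z.1) (fun z => v z.2).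
  have vP x : `|v x| <= P.
    rewrite /v ler_norml; set m := Num.min _ _.
    have mP : m <= P by rewrite ge_min lexx.
    by case: (leP (- P) m) => h; apply/andP; split; lra.
  apply: (close_on_intro d0); [|by exists P => z _; exact: vP..].
  exists 1 => -[x y] _ /=; rewrite mul1r.
  apply: le_trans (maxr_dist _ _ _) _; apply: le_trans (minr_dist _ _ _) _.
  by apply: le_trans (mx_entry_norm _ 1 0); rewrite !mxE.
(* Only [u] is unbounded.  In terms of [w = 1 / u] the velocity and the force
   are bounded Lipschitz expressions [V] and [G], up to the linear term
   [- 2 * kappa * u] of the force. *)
pose w x := (u x)^-1.
have wP x : `|w x| <= a^-1.
  by have ux := u0 x; rewrite /w ger0_norm ?lef_pV2// invr_ge0 ltW.
have wC : close_on D d (fun z => w z.1) (fun z => w z.2).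
  apply: (close_on_intro d0); [|by exists a^-1 => z _; exact: wP..].
  exists (a^-1 * a^-1) => -[x y] _ /=.
  have -> : w x - w y = w x * w y * - (u x - u y).
    by rewrite /w; field; rewrite !gt_eqF.
  have uxy : `|u x - u y| <= d (x, y) := u_lip x y.
  have wxy : `|w x * w y| <= a^-1 * a^-1 by rewrite normrM; apply: ler_pM.
  by rewrite normrM normrN; apply: ler_pM.
have quotC e : 0 <= e -> close_on D d (fun z => (1 + e * w z.1 ^+ 2)^-1)
                                   (fun z => (1 + e * w z.2 ^+ 2)^-1).
  move=> e0; apply: (@close_onV _ _ _ _ d0 1) => //.
  - by move=> *; exact: ge1_add_mul_sqr.
  - by move=> *; exact: ge1_add_mul_sqr.
  - by close_step.
have quot1 := quotC 1 ler01; have quot2 := quotC 2 (ler0n R 2).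
pose V (w v : R) := v * 2^-1 * (1 + w ^+ 2 * (1 + 1 * w ^+ 2)^-1).
pose G (w v : R) := v ^+ 2 * 2^-1 * (w ^+ 3 * (1 + 1 * w ^+ 2)^-1 ^+ 2)
  + b ^+ 2 * w ^+ 3 + c ^+ 2 * (w ^+ 3 * (1 + 2 * w ^+ 2)^-1 ^+ 2).
have VC : close_on D d (fun z => V (w z.1) (v z.1)) (fun z => V (w z.2) (v z.2)).
  by rewrite /V; close_step.
have GC : close_on D d (fun z => G (w z.1) (v z.1)) (fun z => G (w z.2) (v z.2)).
  by rewrite /G; close_step.
have VE x : radial_velocity (u x) (v x) = V (w x) (v x).
  have := add_sqr_neq0 (u x) (ltr01 : 0 < (1 : R)); rewrite /radial_velocity /V /w => H.
  have ux := u0 x; rewrite addrC in H; field.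
  by rewrite H gt_eqF.
have GE x : radial_force kappa b c (u x) (v x) = G (w x) (v x) - 2 * kappa * u x.
  have := add_sqr_neq0 (u x) (ltr01 : 0 < (1 : R)).
  have := add_sqr_neq0 (u x) (ltr0Sn R 1); rewrite /radial_force /G /w => H1 H2.
  have ux := u0 x; rewrite addrC in H1; rewrite addrC in H2; field.
  by rewrite ?H1 ?H2 gt_eqF.
have [C1 H1] := VC; have [C2 H2] := GC.
exists (`|C1| + `|C2| + 2 * kappa + 1).
  by have := normr_ge0 C1; have := normr_ge0 C2; lra.
move=> x y; have [h1 _ _] := H1 (x, y) I; have [h2 _ _] := H2 (x, y) I.
have n1 := normr_ge0 C1; have n2 := normr_ge0 C2; have n0 := normr_ge0 (x - y).
have m1 := ler_norm C1; have m2 := ler_norm C2.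
split.
  rewrite !VE; apply: le_trans h1 _; rewrite /d /= ler_wpM2r//; lra.
rewrite !GE.
have -> : G (w x) (v x) - 2 * kappa * u x - (G (w y) (v y) - 2 * kappa * u y) =
  (G (w x) (v x) - G (w y) (v y)) + - (2 * kappa * (u x - u y)) by ring.
apply: le_trans (ler_normD _ _) _.
apply: (@le_trans _ _ (C2 * `|x - y| + 2 * kappa * `|x - y|)).
  apply: lerD => //; rewrite normrN normrM ger0_norm ?mulr_ge0//.
  by rewrite ler_wpM2l ?mulr_ge0// u_lip.
rewrite -mulrDl ler_wpM2r//; lra.
Qed.

(** Global existence of the radial motion.  Conservation of energy keeps it in
    the region where the frozen field is the true one. *)
Lemma radial_motion {R : realType} (kappa b c q0 p0 : R) :
  0 <= kappa -> b != 0 -> 0 < q0 ->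
  exists q p : R -> R, [/\ q 0 = q0, p 0 = p0, (forall t, 0 < q t),
    (forall t : R, is_derive t 1 q (radial_velocity (q t) (p t))) &
    (forall t : R, is_derive t 1 p (radial_force kappa b c (q t) (p t)))].
Proof.
move=> k0 b0 q00.
pose E := radial_energy kappa b c q0 p0.
have [E1 E2] := @radial_energy_bounds R kappa b c q0 p0 k0 q00; rewrite -/E in E1 E2.
have E0 : 0 <= E by have := sqr_ge0 p0; lra.
(* [4 E < P ^+ 2] gives [|p| < P], and [2 E < P ^+ 2] gives [a < q] *)
pose P := E + 2; have P0 : 0 < P by rewrite /P; lra.
pose a := `|b| / P; have a0 : 0 < a by rewrite divr_gt0// normr_gt0.
have [L L0 HL] := @radial_field_lipschitz R kappa b c a P k0 a0 (ltW P0).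
set u := fun y : 'cV[R]_2 => Num.max a (y 0 0) in HL.
set v := fun y : 'cV[R]_2 => Num.max (- P) (Num.min P (y 1 0)) in HL.
pose F (y : 'cV[R]_2) : 'cV[R]_2 := \col_i
  (if i == 0 then radial_velocity (u y) (v y) else radial_force kappa b c (u y) (v y)).
pose x0 : 'cV[R]_2 := \col_i (if i == 0 then q0 else p0).
have [|x [x_0 xE]] := @picard_lindelof R _ _ F L x0 L0.
  move=> y z; apply: mx_norm_le => [|i j]; first by rewrite mulr_ge0// ltW.
  by rewrite !mxE; case: ifP => _; case: (HL y z).
pose q t := x t 0 0; pose p t := x t 1 0.
have qE (t : R) : is_derive t 1 q (radial_velocity (u (x t)) (v (x t))).
  by have /is_derive_mx/(_ 0 0) := xE t; rewrite mxE eqxx.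
have pE (t : R) : is_derive t 1 p (radial_force kappa b c (u (x t)) (v (x t))).
  by have /is_derive_mx/(_ 1 0) := xE t; rewrite mxE.
have qc := is_derive_continuous qE; have pc := is_derive_continuous pE.
have q_0 : q 0 = q0 by rewrite /q x_0 mxE.
have p_0 : p 0 = p0 by rewrite /p x_0 mxE.
pose g t := Num.min (q t - a) (P - `|p t|).
have gE t : (0 < g t) = (a < q t) && (`|p t| < P) by rewrite /g lt_min !subr_gt0.
have trueE t : 0 < g t -> u (x t) = q t /\ v (x t) = p t.
  rewrite gE => /andP[qa]; rewrite ltr_norml => /andP[p1 p2]; split.
    by rewrite /u -/(q t) max_r// ltW.
  by rewrite /v -/(p t) min_r ?max_r// ltW.
have good (r z : R) : 0 <= r -> z ^+ 2 <= 4 * E -> b ^+ 2 <= 2 * E * r ^+ 2 ->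
    (a < r) && (`|z| < P).
  move=> q_ge0 pH qH; apply/andP; split.
    rewrite ltNge; apply/negP => qa.
    have : 0 < b ^+ 2 by rewrite exprn_even_gt0.
    have bE : b ^+ 2 = a ^+ 2 * P ^+ 2.
      by rewrite /a exprMn exprVn divfK ?real_normK ?num_real// sqrf_eq0 gt_eqF.
    have : r ^+ 2 <= a ^+ 2 by rewrite ler_sqr ?nnegrE// ltW.
    move=> qa2 b20; have : 2 * E * r ^+ 2 <= 2 * E * a ^+ 2.
      by rewrite ler_wpM2l// mulr_ge0.
    have a2 : 0 < a ^+ 2 by rewrite exprn_gt0.
    have : 0 < a ^+ 2 * (P ^+ 2 - 2 * E).
      by rewrite mulr_gt0// /P; have := sqr_ge0 E; rewrite expr2; nra.
    rewrite mulrBr -bE; lra.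
  rewrite ltNge; apply/negP => Pp.
  have : P ^+ 2 <= `|z| ^+ 2 by rewrite ler_sqr ?nnegrE// ltW.
  rewrite real_normK ?num_real// /P; have := sqr_ge0 E; rewrite expr2; nra.
have gc : continuous g.
  move=> t; apply: (@continuous_min _ _ (fun t => q t - a) (fun t => P - `|p t|)).
    by apply: continuousB; [exact: qc|exact: cst_continuous].
  apply: continuousB; first exact: cst_continuous.
  by apply: continuous_comp; [exact: pc|exact: norm_continuous].
have gpos : forall t, 0 < g t.
  apply: (continuation gc) => T T0 HT s sT.
  have [T00|T00] := eqVneq T 0.
    move: sT; rewrite T00 normr_le0 => /eqP ->.
    by rewrite gE q_0 p_0; apply: good => //; exact: ltW.
  have {}T0 : 0 < T by rewrite lt_neqAle eq_sym T00.
  have Econst r : `|r| < T -> radial_energy kappa b c (q r) (p r) = E.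
    move=> rT; rewrite /E -q_0 -p_0.
    pose h s := radial_energy kappa b c (q s) (p s).
    have hE (z : R) : `|z| < T -> is_derive z 1 h 0.
      move=> zT; have [uz vz] := trueE _ (HT z zT).
      have qz : q z != 0.
        by move: (HT z zT); rewrite gE => /andP[az _]; rewrite gt_eqF// (lt_trans a0).
      have q'z := qE z; have p'z := pE z; rewrite uz vz in q'z p'z.
      exact: (radial_energy_conserved qz q'z p'z).
    exact: (is_derive_0_ball hE rT).
  have qpos r : `|r| < T -> 0 < q r.
    by move=> rT; move: (HT r rT); rewrite gE => /andP[az _]; rewrite (lt_trans a0).
  have B r : `|r| < T -> p r ^+ 2 <= 4 * E /\ b ^+ 2 <= 2 * E * q r ^+ 2.
    by move=> rT; rewrite -(Econst r rT); apply: radial_energy_bounds; auto.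
  rewrite gE; apply: good.
  - by apply: (continuous_ge0_closed qc T0) sT => r /qpos/ltW.
  - rewrite -subr_ge0.
    apply: (@continuous_ge0_closed R (fun r => 4 * E - p r ^+ 2) T) sT => //.
      apply: (@is_derive_continuous _ _ _ (fun t =>
        0 - 2 * p t * radial_force kappa b c (u (x t)) (v (x t)))) => r.
      by isder; rewrite expr1; ring.
    by move=> r /B[h _]; lra.
  - rewrite -subr_ge0.
    apply: (@continuous_ge0_closed R (fun r => 2 * E * q r ^+ 2 - b ^+ 2) T) sT => //.
      apply: (@is_derive_continuous _ _ _ (fun t =>
        2 * E * (2 * q t * radial_velocity (u (x t)) (v (x t))))) => r.
      by isder; rewrite ?expr1; ring.
    by move=> r /B[_ h]; lra.
exists q, p; split => //.
- by move=> t; move: (gpos t); rewrite gE => /andP[az _]; rewrite (lt_trans a0).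
- by move=> t; have := qE t; have [-> ->] := trueE _ (gpos t).
- by move=> t; have := pE t; have [-> ->] := trueE _ (gpos t).
Qed.

(** * The Hamiltonian system *)

Lemma ord2_ind (P : 'I_2 -> Prop) : P 0 -> P 1 -> forall i, P i.
Proof.
by move=> P0 P1 [[|[|//]] i]; [move: P0|move: P1]; congr (P _); exact: val_inj.
Qed.

Lemma ord3_ind (P : 'I_3 -> Prop) : P 0 -> P 1 -> P 2 -> forall i, P i.
Proof.
move=> P0 P1 P2 [[|[|[|//]]] i]; [move: P0|move: P1|move: P2];
by congr (P _); exact: val_inj.
Qed.

Lemma vec3E {R : realType} (a b c : R) :
  [/\ vec3 a b c 0 0 = a, vec3 a b c 1 0 = b & vec3 a b c 2 0 = c].
Proof. by split; rewrite mxE. Qed.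

Lemma eq_vec3 {R : realType} (v : 'cV[R]_3) (a b c : R) :
  v 0 0 = a -> v 1 0 = b -> v 2 0 = c -> v = vec3 a b c.
Proof.
move=> va vb vc; apply/colP; have [ea eb ec] := vec3E a b c.
by apply: ord3_ind; [rewrite va ea|rewrite vb eb|rewrite vc ec].
Qed.

Lemma is_derive_vec3 {R : realType} (x : R -> 'cV[R]_3) (a b c t : R) :
  is_derive t 1 x (vec3 a b c) <->
  [/\ is_derive t 1 (fun s => x s 0 0) a, is_derive t 1 (fun s => x s 1 0) b
    & is_derive t 1 (fun s => x s 2 0) c].
Proof.
have [ea eb ec] := vec3E a b c.
rewrite is_derive_mx; split=> [H|[Ha Hb Hc] i j].
  by split; [have := H 0 0|have := H 1 0|have := H 2 0]; rewrite ?ea ?eb ?ec.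
by rewrite (ord1 j); move: i; apply: ord3_ind; rewrite ?ea ?eb ?ec.
Qed.

Lemma is_derive_derive1 {R : realType} {V : normedModType R} (f : R -> V)
    (t : R) (d : V) :
  is_derive t 1 f d -> f^`() t = d.
Proof. by move=> fd; rewrite derive1E; case: fd. Qed.

Lemma derive1_is_derive {R : realType} {V : normedModType R} (f : R -> V)
    (t : R) (d : V) :
  derivable f t 1 -> f^`() t = d -> is_derive t 1 f d.
Proof. by move=> df <-; apply: DeriveDef => //; rewrite derive1E. Qed.

Lemma derivable_continuous {R : realType} (f : R -> R) :
  (forall t : R, exists d, is_derive t 1 f d) -> continuous f.
Proof. by move=> /choice[df]; exact: is_derive_continuous. Qed.

Lemma Ck1_intro {R : realType} {V : normedModType R} (f df : R -> V) :
  (forall t : R, is_derive t 1 f (df t)) -> continuous df -> Ck 1 f.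
Proof.
move=> fE cdf; split.
  by move=> [|//] t _; have := fE t => ?; exact: ex_derive.
have -> // : f^`(1) = df by apply/funext => t; exact: is_derive_derive1.
Qed.

(** The Hamiltonian system, coordinate by coordinate: the last two momenta are
    constant, and the first coordinate and momentum decouple. *)
Lemma global_solution_coords {R : realType} (kappa : R) (q0 xi0 : 'cV[R]_3)
    (q xi : R -> 'cV[R]_3) :
  global_solution kappa q0 xi0 q xi <->
  [/\ forall t, 0 < q t 0 0, q 0 = q0 /\ xi 0 = xi0,
      forall t, xi t 1 0 = xi0 1 0 /\ xi t 2 0 = xi0 2 0,
      forall t : R,
        is_derive t 1 (fun s => q s 0 0) (radial_velocity (q t 0 0) (xi t 0 0)) /\
        is_derive t 1 (fun s => xi s 0 0)
          (radial_force kappa (xi0 1 0) (xi0 2 0) (q t 0 0) (xi t 0 0)) &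
      forall t : R,
        is_derive t 1 (fun s => q s 1 0) (xi0 1 0 / q t 0 0 ^+ 2) /\
        is_derive t 1 (fun s => q s 2 0) (xi0 2 0 / (2 + q t 0 0 ^+ 2))].
Proof.
split.
  move=> [[dq _] [dxi _] q_pos [q_0 xi_0] eqs].
  have qE (t : R) : is_derive t 1 q _ := derive1_is_derive (dq 0 t isT) (eqs t).1.
  have xiE (t : R) : is_derive t 1 xi _ := derive1_is_derive (dxi 0 t isT) (eqs t).2.
  have cst i : (forall t : R, is_derive t 1 (fun s => xi s i 0) 0) ->
      forall t, xi t i 0 = xi0 i 0.
    by move=> H t; rewrite -xi_0; exact: (@is_derive_0_is_cst _ (fun s => xi s i 0)).
  have c1 : forall t, xi t 1 0 = xi0 1 0.
    by apply: cst => t; have [_ ? _] := (is_derive_vec3 _ _ _ _ _).1 (xiE t).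
  have c2 : forall t, xi t 2 0 = xi0 2 0.
    by apply: cst => t; have [_ _ ?] := (is_derive_vec3 _ _ _ _ _).1 (xiE t).
  split => // t.
  - have [? _ _] := (is_derive_vec3 _ _ _ _ _).1 (qE t).
    have [? _ _] := (is_derive_vec3 _ _ _ _ _).1 (xiE t).
    by rewrite -(c1 t) -(c2 t).
  - have [_ ? ?] := (is_derive_vec3 _ _ _ _ _).1 (qE t).
    by rewrite -(c1 t) -(c2 t).
move=> [q_pos [q_0 xi_0] c rad ang].
have q1E (t : R) := (rad t).1; have p1E (t : R) := (rad t).2.
have n0 t : q t 0 0 != 0 by rewrite gt_eqF.
have n1 t : 1 + q t 0 0 ^+ 2 != 0 by exact: add_sqr_neq0.
have n2 t : 2 + q t 0 0 ^+ 2 != 0 by exact: add_sqr_neq0.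
have qE (t : R) : is_derive t 1 q (vec3 (radial_velocity (q t 0 0) (xi t 0 0))
    (xi0 1 0 / q t 0 0 ^+ 2) (xi0 2 0 / (2 + q t 0 0 ^+ 2))).
  by apply/is_derive_vec3; have [] := ang t.
have xiE (t : R) : is_derive t 1 xi (vec3
    (radial_force kappa (xi0 1 0) (xi0 2 0) (q t 0 0) (xi t 0 0)) 0 0).
  apply/is_derive_vec3; split => //.
  - have -> : (fun s => xi s 1 0) = (fun=> xi0 1 0) by apply/funext => s; exact: (c s).1.
    exact: is_derive_cst.
  - have -> : (fun s => xi s 2 0) = (fun=> xi0 2 0) by apply/funext => s; exact: (c s).2.
    exact: is_derive_cst.
split => //.
- apply: (Ck1_intro qE); apply/continuous_mx => i j; rewrite (ord1 j).
  move: i; apply: ord3_ind; under eq_fun do rewrite mxE /=;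
    apply: derivable_continuous => t; rewrite /radial_velocity; eexists; isder_step;
    by rewrite ?mulf_neq0 ?expf_neq0.
- apply: (Ck1_intro xiE); apply/continuous_mx => i j; rewrite (ord1 j).
  move: i; apply: ord3_ind; under eq_fun do rewrite mxE /=;
    apply: derivable_continuous => t; rewrite /radial_force; eexists; isder_step;
    by rewrite ?mulf_neq0 ?expf_neq0.
- move=> t; rewrite /= (c t).1 (c t).2; split; exact: is_derive_derive1.
Qed.

Lemma global_solution_exists {R : realType} (kappa : R) (q0 xi0 : 'cV[R]_3) :
  0 <= kappa -> R3plus q0 -> xi0 1 0 != 0 ->
  exists q xi, global_solution kappa q0 xi0 q xi.
Proof.
move=> k0 q0_pos b0.
have [r [p [r_0 p_0 r_pos rE pE]]] :=
  @radial_motion R kappa (xi0 1 0) (xi0 2 0) (q0 0 0) (xi0 0 0) k0 b0 q0_pos.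
have [f [f0 fE]] : exists F : R -> R, F 0 = 0 /\
    forall t : R, is_derive t 1 F (xi0 1 0 / r t ^+ 2).
  apply: continuous_primitive; apply: derivable_continuous => t.
  by eexists; isder_step; rewrite expf_neq0// gt_eqF.
have [g [g0 gE]] : exists F : R -> R, F 0 = 0 /\
    forall t : R, is_derive t 1 F (xi0 2 0 / (2 + r t ^+ 2)).
  apply: continuous_primitive; apply: derivable_continuous => t.
  by eexists; isder_step; rewrite add_sqr_neq0.
pose q t := vec3 (r t) (q0 1 0 + f t) (q0 2 0 + g t).
pose xi t := vec3 (p t) (xi0 1 0) (xi0 2 0).
exists q, xi; apply/global_solution_coords.
have qs t : [/\ q t 0 0 = r t, q t 1 0 = q0 1 0 + f t
    & q t 2 0 = q0 2 0 + g t] := vec3E _ _ _.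
have xis t : [/\ xi t 0 0 = p t, xi t 1 0 = xi0 1 0
    & xi t 2 0 = xi0 2 0] := vec3E _ _ _.
have Q0 : (fun s => q s 0 0) = r by apply/funext => s; case: (qs s).
have Q1 : (fun s => q s 1 0) = (fun s => q0 1 0 + f s) by apply/funext => s; case: (qs s).
have Q2 : (fun s => q s 2 0) = (fun s => q0 2 0 + g s) by apply/funext => s; case: (qs s).
have X0 : (fun s => xi s 0 0) = p by apply/funext => s; case: (xis s).
split.
- by move=> t; have [-> _ _] := qs t.
- by split; apply/esym/eq_vec3; rewrite ?r_0 ?p_0 ?f0 ?g0 ?addr0.
- by move=> t; have [_ -> ->] := xis t.
- by move=> t; rewrite Q0 X0; have [-> _ _] := qs t; have [-> _ _] := xis t.
- move=> t; rewrite Q1 Q2; have [-> _ _] := qs t.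
  by split; isder; rewrite add0r.
Qed.

(** Two solutions share their angular momenta; their radii and radial momenta
    agree by Gronwall, and then so do the derivatives of the angles. *)
Lemma global_solution_unique {R : realType} (kappa : R) (q0 xi0 : 'cV[R]_3)
    (q xi q' xi' : R -> 'cV[R]_3) :
  global_solution kappa q0 xi0 q xi -> global_solution kappa q0 xi0 q' xi' ->
  q = q' /\ xi = xi'.
Proof.
move=> /global_solution_coords[q_pos [q_0 xi_0] c rad ang].
move=> /global_solution_coords[q'_pos [q'_0 xi'_0] c' rad' ang'].
set b := xi0 1 0 in c c' rad rad' ang ang'; set e := xi0 2 0 in c c' rad rad' ang ang'.
pose r t := q t 0 0; pose p t := xi t 0 0; pose r' t := q' t 0 0; pose p' t := xi' t 0 0.
have rE (t : R) : is_derive t 1 r (radial_velocity (r t) (p t)) := (rad t).1.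
have pE (t : R) : is_derive t 1 p (radial_force kappa b e (r t) (p t)) := (rad t).2.
have r'E (t : R) : is_derive t 1 r' (radial_velocity (r' t) (p' t)) := (rad' t).1.
have p'E (t : R) : is_derive t 1 p' (radial_force kappa b e (r' t) (p' t)) := (rad' t).2.
pose f (i : bool) t := if i then r t - r' t else p t - p' t.
pose df (i : bool) t := if i
  then radial_velocity (r t) (p t) - radial_velocity (r' t) (p' t)
  else radial_force kappa b e (r t) (p t) - radial_force kappa b e (r' t) (p' t).
have f0 : forall i t, f i t = 0.
  apply: (@gronwall_family_zero R bool f df).
  - by move=> [] t; rewrite /f /df; exact: is_deriveB.
  - by move=> []; rewrite /f /r /r' /p /p' ?q_0 ?q'_0 ?xi_0 ?xi'_0 subrr.
  move=> T i.
  pose D := [set t : R | `|t| <= T].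
  pose d (t : R) := \sum_j `|f j t|.
  have d0 t : 0 <= d t by apply: sumr_ge0.
  have fd j t : `|f j t| <= 1 * d t.
    by rewrite mul1r /d (bigD1 j)//= lerDl sumr_ge0.
  have rC : close_on D d r r'.
    apply: close_on_intro => //.
    - by exists 1 => t _; exact: (fd true).
    - by apply: continuous_bounded_on; exact: is_derive_continuous rE.
    - by apply: continuous_bounded_on; exact: is_derive_continuous r'E.
  have pC : close_on D d p p'.
    apply: close_on_intro => //.
    - by exists 1 => t _; exact: (fd false).
    - by apply: continuous_bounded_on; exact: is_derive_continuous pE.
    - by apply: continuous_bounded_on; exact: is_derive_continuous p'E.
  have [m m0 Hm] := continuous_positive_on T (is_derive_continuous rE) q_pos.
  have [m' m'0 Hm'] := continuous_positive_on T (is_derive_continuous r'E) q'_pos.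
  have rV : close_on D d (fun t => (r t)^-1) (fun t => (r' t)^-1).
    apply: (@close_onV _ _ _ _ d0 (Num.min m m')) => //.
    - by rewrite lt_min m0.
    - by move=> t /Hm; rewrite ge_min => ->.
    - by move=> t /Hm'; rewrite ge_min => ->; rewrite orbT.
  have sV (s : R) : 0 < s -> close_on D d (fun t => (s + r t ^+ 2)^-1)
                                          (fun t => (s + r' t ^+ 2)^-1).
    move=> s0; apply: (@close_onV _ _ _ _ d0 s) => //.
    - by move=> t _; rewrite lerDl sqr_ge0.
    - by move=> t _; rewrite lerDl sqr_ge0.
    - by close_step.
  have s1 := sV 1 ltr01; have s2 := sV 2 (ltr0Sn R 1).
  have VE t s : radial_velocity t s = (2 + t ^+ 2) * s * (2^-1 * (1 + t ^+ 2)^-1).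
    by rewrite /radial_velocity invfM.
  have GE t s : radial_force kappa b e t s =
      (s ^+ 2 * (2^-1 * (1 + t ^+ 2)^-1 ^+ 2) + b ^+ 2 * t^-1 ^+ 4
       + e ^+ 2 * (2 + t ^+ 2)^-1 ^+ 2 - 2 * kappa) * t.
    by rewrite /radial_force invfM !exprVn.
  have VC : close_on D d (fun t => radial_velocity (r t) (p t))
                         (fun t => radial_velocity (r' t) (p' t)).
    under eq_fun do rewrite VE; under [X in close_on _ _ _ X]eq_fun do rewrite VE.
    by close_step.
  have GC : close_on D d (fun t => radial_force kappa b e (r t) (p t))
                         (fun t => radial_force kappa b e (r' t) (p' t)).
    under eq_fun do rewrite GE; under [X in close_on _ _ _ X]eq_fun do rewrite GE.
    by close_step.
  have [C1 H1] := VC; have [C2 H2] := GC.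
  by case: i; [exists C1|exists C2] => t tT; [have [] := H1 t tT|have [] := H2 t tT].
have rr' t : q t 0 0 = q' t 0 0 by have /eqP := f0 true t; rewrite subr_eq0 => /eqP.
have pp' t : xi t 0 0 = xi' t 0 0 by have /eqP := f0 false t; rewrite subr_eq0 => /eqP.
have ang_eq i (dq : R -> R) : (forall t : R, is_derive t 1 (fun s => q s i 0) (dq t)) ->
    (forall t : R, is_derive t 1 (fun s => q' s i 0) (dq t)) ->
    forall t, q t i 0 = q' t i 0.
  move=> H H' t; apply/eqP; rewrite -subr_eq0; apply/eqP.
  have -> : 0 = q 0 i 0 - q' 0 i 0 by rewrite q_0 q'_0 subrr.
  apply: (@is_derive_0_is_cst _ (fun s => q s i 0 - q' s i 0)) => s.
  by isder; rewrite subrr.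
split; apply/funext => t; apply/colP; apply: ord3_ind => //.
- apply: (ang_eq _ (fun t => b / q t 0 0 ^+ 2)) => s; first exact: (ang s).1.
  by rewrite rr'; exact: (ang' s).1.
- apply: (ang_eq _ (fun t => e / (2 + q t 0 0 ^+ 2))) => s; first exact: (ang s).2.
  by rewrite rr'; exact: (ang' s).2.
- by rewrite (c t).1 (c' t).1.
- by rewrite (c t).2 (c' t).2.
Qed.

(** * The metric in polar coordinates *)

Lemma mx2E {R : realType} (a b c d : R) :
  [/\ mx2 a b c d 0 0 = a, mx2 a b c d 0 1 = b, mx2 a b c d 1 0 = c
    & mx2 a b c d 1 1 = d].
Proof. by split; rewrite mxE. Qed.

Lemma eq_mx2 {R : realType} (A : 'M[R]_2) (a b c d : R) :
  A 0 0 = a -> A 0 1 = b -> A 1 0 = c -> A 1 1 = d -> A = mx2 a b c d.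
Proof.
move=> Aa Ab Ac Ad; have [ea eb ec ed] := mx2E a b c d.
apply/matrixP; apply: ord2_ind; apply: ord2_ind;
by [rewrite Aa ea|rewrite Ab eb|rewrite Ac ec|rewrite Ad ed].
Qed.

Lemma sum2 {R : nmodType} (F : 'I_2 -> R) : \sum_i F i = F 0 + F 1.
Proof. by rewrite !big_ord_recl big_ord0 addr0; congr (_ + F _); exact: val_inj. Qed.

Lemma sum3 {R : nmodType} (F : 'I_3 -> R) : \sum_i F i = F 0 + F 1 + F 2.
Proof.
rewrite !big_ord_recl big_ord0 addr0 addrA.
by congr (_ + F _ + F _); exact: val_inj.
Qed.

Lemma innerE {R : realType} (A B : 'M[R]_2) :
  inner A B = A 0 0 * B 0 0 + A 1 0 * B 1 0 + (A 0 1 * B 0 1 + A 1 1 * B 1 1).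
Proof. by rewrite /inner /mxtrace sum2 !mxE !sum2 !mxE. Qed.

Lemma sqrt2V_sqr {R : realType} : (Num.sqrt 2)^-1 ^+ 2 = 2^-1 :> R.
Proof. by rewrite exprVn sqr_sqrtr. Qed.

Lemma phiE {R : realType} (x : 'cV[R]_3) :
  let rho := Num.sqrt (2 + x 0 0 ^+ 2 + x 1 0 ^+ 2) in
  let s := (Num.sqrt 2)^-1 in
  phi x = mx2 (s * (rho * cos (x 2 0) + x 0 0)) (s * (- (rho * sin (x 2 0)) + x 1 0))
              (s * (rho * sin (x 2 0) + x 1 0)) (s * (rho * cos (x 2 0) - x 0 0)).
Proof.
move=> rho s; apply: eq_mx2; rewrite /phi /matI /matZ /matK /matM !mxE /=;
by congr (_ * _); rewrite -/rho; ring.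
Qed.

(** Chain rule along a curve. *)
Lemma is_derive_curve {R : realType} {V W : normedModType R} (f : V -> W)
    (g : R -> V) (t : R) (v : V) :
  differentiable f (g t) -> is_derive t 1 g v ->
  is_derive t 1 (fun s => f (g s)) ('d f (g t) v).
Proof.
move=> df [dg <-].
have dg' : differentiable g t by apply/derivable1_diffP.
have dfg : differentiable (f \o g) t by exact: differentiable_comp.
apply: DeriveDef; first exact/derivable1_diffP.
by rewrite deriveE// diff_comp// deriveE.
Qed.

Lemma is_derive_line {R : realType} {V : normedModType R} (x v : V) :
  is_derive (0 : R) 1 (fun h : R => h *: v + x) v.
Proof.
have d : differentiable (fun h : R => h *: v) (0 : R) by exact: differentiableZl.
have {2}-> : v = v + 0 by rewrite addr0.
apply: is_deriveD.
apply: DeriveDef; first exact/derivable1_diffP.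
by rewrite deriveE// diffZl// diff_val scale1r.
Qed.

(** A differential is computed by a derivative along a line. *)
Lemma diff_line {R : realType} {V W : normedModType R} (f : V -> W) (x v : V) (d : W) :
  differentiable f x -> is_derive (0 : R) 1 (fun h : R => f (h *: v + x)) d ->
  'd f x v = d.
Proof.
move=> df [_ <-].
have dfx : differentiable f (0 *: v + x) by rewrite scale0r add0r.
have [_ ->] := is_derive_curve dfx (is_derive_line x v).
by rewrite scale0r add0r.
Qed.

Lemma differentiable_comp1 {R : realType} {V : normedModType R} (g : R -> R)
    (f : V -> R) (x : V) :
  differentiable f x -> derivable g (f x) 1 -> differentiable (fun y => g (f y)) x.
Proof.
by move=> df dg; apply: differentiable_comp => //; exact/derivable1_diffP.
Qed.

Section phi_differential.
Context {R : realType}.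
Implicit Types x v w : 'cV[R]_3.

Lemma phi_radicand_gt0 x : 0 < 2 + x 0 0 ^+ 2 + x 1 0 ^+ 2.
Proof. by rewrite -addrA ltr_pwDl// addr_ge0 ?sqr_ge0. Qed.

Lemma differentiable_phi x : differentiable (@phi R) x.
Proof.
have co i : differentiable (fun y : 'cV[R]_3 => y i 0) x by exact: differentiable_coord.
pose r (y : 'cV[R]_3) := Num.sqrt (2 + y 0 0 ^+ 2 + y 1 0 ^+ 2).
have dr : differentiable r x.
  apply: (@differentiable_comp1 _ _ Num.sqrt).
    have := differentiableD (differentiableD (@differentiable_cst _ _ _ (2 : R) x)
      (differentiableX 1 (co 0))) (differentiableX 1 (co 1)).
    by congr (differentiable _ _); apply/funext => y; rewrite !fctE.
  by case: (is_derive1_sqrt (phi_radicand_gt0 x)).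
have -> : @phi R = (Num.sqrt 2)^-1 *:
   ((fun y => (r y * cos (y 2 0)) *: (matI : 'M[R]_2))
    + (fun y => (r y * sin (y 2 0)) *: (matZ : 'M[R]_2))
    + (fun y => y 0 0 *: (matK : 'M[R]_2)) + (fun y => y 1 0 *: (matM : 'M[R]_2))).
  by apply/funext => y; rewrite /phi !fctE -/(r y) (scalerDr (r y)) !scalerA.
apply: differentiableZ.
apply: differentiableD; last exact: differentiableZl.
apply: differentiableD; last exact: differentiableZl.
apply: differentiableD; apply: differentiableZl.
  apply: (@differentiableM _ _ r (fun y => cos (y 2 0))) => //.
  exact: differentiable_comp1.
apply: (@differentiableM _ _ r (fun y => sin (y 2 0))) => //.
exact: differentiable_comp1.
Qed.

Lemma diff_phiE x v :
  let rho := Num.sqrt (2 + x 0 0 ^+ 2 + x 1 0 ^+ 2) in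
  let s := (Num.sqrt 2)^-1 in
  let a := (x 0 0 * v 0 0 + x 1 0 * v 1 0) / rho in
  let c := cos (x 2 0) in let n := sin (x 2 0) in
  'd phi x v = mx2 (s * (a * c - rho * v 2 0 * n + v 0 0))
                   (s * (- (a * n + rho * v 2 0 * c) + v 1 0))
                   (s * (a * n + rho * v 2 0 * c + v 1 0))
                   (s * (a * c - rho * v 2 0 * n - v 0 0)).
Proof.
move=> rho s a c n; apply: diff_line; first exact: differentiable_phi.
have r0 := phi_radicand_gt0 x.
have rho0 : rho != 0 by rewrite gt_eqF// sqrtr_gt0.
apply/is_derive_mx; apply: ord2_ind; apply: ord2_ind;
rewrite mxE /=; under eq_fun do rewrite phiE mxE /= !mxE;
  (isder; [by rewrite !mul0r !add0r|rewrite !mul0r !add0r -/rho -/c -/n /a;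
   rewrite ?expr1 -/s; field; by rewrite rho0]).
Qed.

Lemma inner_diff_phi x v w :
  inner ('d phi x v) ('d phi x w) =
  (x 0 0 * v 0 0 + x 1 0 * v 1 0) * (x 0 0 * w 0 0 + x 1 0 * w 1 0)
    / (2 + x 0 0 ^+ 2 + x 1 0 ^+ 2)
  + (2 + x 0 0 ^+ 2 + x 1 0 ^+ 2) * v 2 0 * w 2 0 + v 0 0 * w 0 0 + v 1 0 * w 1 0.
Proof.
have r0 := phi_radicand_gt0 x.
rewrite !diff_phiE innerE !mxE /=.
set s := (Num.sqrt 2)^-1; set rho := Num.sqrt _; set c := cos _; set n := sin _.
have rho2 : rho ^+ 2 = 2 + x 0 0 ^+ 2 + x 1 0 ^+ 2 by rewrite sqr_sqrtr// ltW.
have rho0 : rho != 0 by rewrite gt_eqF// sqrtr_gt0.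
have cn : c ^+ 2 + n ^+ 2 = 1 by exact: cos2Dsin2.
rewrite -rho2.
set a := (x 0 0 * v 0 0 + _) / rho; set b := (x 0 0 * w 0 0 + _) / rho.
transitivity (2 * s ^+ 2 * ((a * b + rho ^+ 2 * v 2 0 * w 2 0) * (c ^+ 2 + n ^+ 2)
   + v 0 0 * w 0 0 + v 1 0 * w 1 0)); first by ring.
by rewrite cn sqrt2V_sqr /a /b; field.
Qed.

Lemma X2_diff_phi x v : X2 (phi x) ('d phi x v) = x 0 0 * v 1 0 - x 1 0 * v 0 0.
Proof.
rewrite /X2 diff_phiE phiE innerE /matZ !mxE !sum2 !mxE /=.
set s := (Num.sqrt 2)^-1; set rho := Num.sqrt _; set c := cos _; set n := sin _.
have s2 : s ^+ 2 = 2^-1 := sqrt2V_sqr; clearbody s.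
transitivity (2 * s ^+ 2 * (x 0 0 * v 1 0 - x 1 0 * v 0 0)).
  by field; rewrite gt_eqF// sqrtr_gt0 phi_radicand_gt0.
by rewrite s2 divff ?mul1r.
Qed.

Lemma metric_mulE x w :
  let r := 2 + x 0 0 ^+ 2 + x 1 0 ^+ 2 in
  let a := (x 0 0 * w 0 0 + x 1 0 * w 1 0) / r in
  metric x *m w = vec3 (x 0 0 * a + w 0 0) (x 1 0 * a + w 1 0) (r * w 2 0).
Proof.
move=> r a; have r0 : r != 0 by rewrite gt_eqF// phi_radicand_gt0.
by apply: eq_vec3; rewrite mxE sum3 !mxE !inner_diff_phi !mxE /= -/r /a; field.
Qed.

Lemma psiE x : [/\ psi x 0 0 = x 0 0 * cos (x 1 0),
  psi x 1 0 = x 0 0 * sin (x 1 0) & psi x 2 0 = x 2 0].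
Proof. exact: vec3E. Qed.

Lemma differentiable_psi x : differentiable (@psi R) x.
Proof.
have co i : differentiable (fun y : 'cV[R]_3 => y i 0) x by exact: differentiable_coord.
have -> : @psi R =
   (fun y : 'cV[R]_3 => (y 0 0 * cos (y 1 0)) *: (delta_mx 0 0 : 'cV[R]_3))
   + (fun y => (y 0 0 * sin (y 1 0)) *: (delta_mx 1 0 : 'cV[R]_3))
   + (fun y => y 2 0 *: (delta_mx 2 0 : 'cV[R]_3)).
  apply/funext => y; apply/esym/eq_vec3; rewrite !fctE !mxE /=; ring.
apply: differentiableD; last exact: differentiableZl.
apply: differentiableD; apply: differentiableZl.
  apply: (@differentiableM _ _ (fun y : 'cV[R]_3 => y 0 0) (fun y => cos (y 1 0))) => //.
  exact: differentiable_comp1.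
apply: (@differentiableM _ _ (fun y : 'cV[R]_3 => y 0 0) (fun y => sin (y 1 0))) => //.
exact: differentiable_comp1.
Qed.

Lemma diff_psiE x v :
  'd psi x v = vec3 (v 0 0 * cos (x 1 0) - x 0 0 * v 1 0 * sin (x 1 0))
                    (v 0 0 * sin (x 1 0) + x 0 0 * v 1 0 * cos (x 1 0)) (v 2 0).
Proof.
apply: diff_line; first exact: differentiable_psi.
apply/is_derive_vec3; split; under eq_fun do rewrite mxE /= !mxE;
  by isder; rewrite ?mul0r ?add0r; ring.
Qed.

Lemma jac_psi_mulE x v : jac psi x *m v = 'd psi x v.
Proof.
by rewrite diff_psiE; apply: eq_vec3; rewrite mxE sum3 !mxE !diff_psiE !mxE /=; ring.
Qed.

Lemma jac_psi_trmulE x z :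
  (jac psi x)^T *m z = vec3 (cos (x 1 0) * z 0 0 + sin (x 1 0) * z 1 0)
    (x 0 0 * (cos (x 1 0) * z 1 0 - sin (x 1 0) * z 0 0)) (z 2 0).
Proof. by apply: eq_vec3; rewrite mxE sum3 !mxE !diff_psiE !mxE /=; ring. Qed.

(** In the coordinates of [psi] the metric is diagonal. *)
Lemma metric_polar (q v : 'cV[R]_3) : q 0 0 != 0 ->
  (jac psi q)^T *m (metric (psi q) *m (jac psi q *m v)) =
  vec3 (2 * (1 + q 0 0 ^+ 2) / (2 + q 0 0 ^+ 2) * v 0 0)
       (q 0 0 ^+ 2 * v 1 0) ((2 + q 0 0 ^+ 2) * v 2 0).
Proof.
move=> q0; have r0 := add_sqr_neq0 (q 0 0) (ltr0Sn R 1).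
rewrite jac_psi_mulE metric_mulE jac_psi_trmulE diff_psiE !mxE /=.
set c := cos _; set n := sin _.
have cn : c ^+ 2 + n ^+ 2 = 1 by exact: cos2Dsin2.
have -> : 2 + (q 0 0 * c) ^+ 2 + (q 0 0 * n) ^+ 2 = 2 + q 0 0 ^+ 2.
  transitivity (2 + q 0 0 ^+ 2 * (c ^+ 2 + n ^+ 2)); first ring.
  by rewrite cn mulr1.
have -> : q 0 0 * c * (v 0 0 * c - q 0 0 * v 1 0 * n)
    + q 0 0 * n * (v 0 0 * n + q 0 0 * v 1 0 * c) = q 0 0 * v 0 0.
  transitivity (q 0 0 * v 0 0 * (c ^+ 2 + n ^+ 2)); first ring.
  by rewrite cn mulr1.
congr vec3.
- transitivity ((q 0 0 ^+ 2 / (2 + q 0 0 ^+ 2) * v 0 0 + v 0 0) * (c ^+ 2 + n ^+ 2)).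
    by field.
  by rewrite cn; field.
- transitivity (q 0 0 ^+ 2 * v 1 0 * (c ^+ 2 + n ^+ 2)); first by field.
  by rewrite cn mulr1.
Qed.

(** [Gamma \o Psi] sends a covector to the velocity given by the Hamiltonian
    system, read through [psi]. *)
Lemma Gamma_Psi (q xi : 'cV[R]_3) : R3plus q ->
  (Gamma \o Psi) (q, xi) = (psi q, 'd psi q
    (vec3 (radial_velocity (q 0 0) (xi 0 0)) (xi 1 0 / q 0 0 ^+ 2)
          (xi 2 0 / (2 + q 0 0 ^+ 2)))).
Proof.
move=> q_pos; have q0 : q 0 0 != 0 by rewrite gt_eqF.
have n1 := add_sqr_neq0 (q 0 0) (ltr01 : 0 < (1 : R)).
have n2 := add_sqr_neq0 (q 0 0) (ltr0Sn R 1).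
set v := vec3 _ _ _.
set J := jac psi q; set P := metric (psi q).
(* the metric in polar coordinates; it sends the velocity [v] to [xi] *)
pose G : 'M[R]_3 := diag_mx (\row_i nth 0 [:: 2 * (1 + q 0 0 ^+ 2) / (2 + q 0 0 ^+ 2);
  q 0 0 ^+ 2; 2 + q 0 0 ^+ 2] i).
have GE (w : 'cV[R]_3) : G *m w = vec3 (2 * (1 + q 0 0 ^+ 2) / (2 + q 0 0 ^+ 2) * w 0 0)
       (q 0 0 ^+ 2 * w 1 0) ((2 + q 0 0 ^+ 2) * w 2 0).
  by apply: eq_vec3; rewrite mul_diag_mx !mxE.
have JPJ : J^T *m P *m J = G.
  apply/matrixP => i j.
  have : (J^T *m P *m J) *m (delta_mx j 0 : 'cV_3) = G *m delta_mx j 0.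
    by rewrite -!mulmxA metric_polar// GE.
  by rewrite -!colE => /colP/(_ i); rewrite !mxE.
have Gu : G \in unitmx.
  rewrite unitmxE det_diag unitfE; apply/prodf_neq0 => i _; rewrite mxE; move: i.
  by apply: ord3_ind => //=; rewrite ?sqrf_eq0// !mulf_neq0 ?invr_neq0.
have : J^T *m P *m J \in unitmx by rewrite JPJ.
rewrite !unitmx_mul => /andP[/andP[JTu Pu] Ju].
have Gv : G *m v = xi.
  have [v0 v1 v2] := vec3E (radial_velocity (q 0 0) (xi 0 0)) (xi 1 0 / q 0 0 ^+ 2)
          (xi 2 0 / (2 + q 0 0 ^+ 2)).
  rewrite GE v0 v1 v2; apply/esym/eq_vec3; rewrite /radial_velocity.
  - by field; rewrite n1 n2.
  - by field.
  - by field.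
rewrite /Gamma /Psi /= -/J -/P; congr pair.
rewrite -jac_psi_mulE -/J -Gv -JPJ -!mulmxA trmx_inv mulKmx//.
by rewrite mulKmx.
Qed.

End phi_differential.

(** * The motion of the matrix *)

(** The matrix with coordinates [w], [v], [z], [k] in the basis [matI], [matZ],
    [matK], [matM], scaled by [1 / sqrt 2]. *)
Definition cartan_mx {R : realType} (w v z k : R) : 'M[R]_2 :=
  mx2 ((Num.sqrt 2)^-1 * (w + z)) ((Num.sqrt 2)^-1 * (- v + k))
      ((Num.sqrt 2)^-1 * (v + k)) ((Num.sqrt 2)^-1 * (w - z)).

Lemma cofE {R : realType} (A : 'M[R]_2) :
  cof A = mx2 (A 1 1) (- A 1 0) (- A 0 1) (A 0 0).
Proof. by apply: eq_mx2; rewrite /cof /matZ !mxE !sum2 !mxE !sum2 !mxE /=; ring. Qed.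

Lemma cof_cartan_mx {R : realType} (w v z k : R) :
  cof (cartan_mx w v z k) = cartan_mx w v (- z) (- k).
Proof. by rewrite cofE; apply/esym/eq_mx2; rewrite !mxE /=; ring. Qed.

Lemma scale_cartan_mx {R : realType} (c w v z k : R) :
  c *: cartan_mx w v z k = cartan_mx (c * w) (c * v) (c * z) (c * k).
Proof. by apply: eq_mx2; rewrite !mxE /=; ring. Qed.

Lemma sub_cartan_mx {R : realType} (w v z k w' v' z' k' : R) :
  cartan_mx w v z k - cartan_mx w' v' z' k' =
  cartan_mx (w - w') (v - v') (z - z') (k - k').
Proof. by apply: eq_mx2; rewrite !mxE /=; ring. Qed.

Lemma is_derive_cartan_mx {R : realType} (w v z k : R -> R) (w' v' z' k' t : R) :
  is_derive t 1 w w' -> is_derive t 1 v v' -> is_derive t 1 z z' ->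
  is_derive t 1 k k' ->
  is_derive t 1 (fun s => cartan_mx (w s) (v s) (z s) (k s)) (cartan_mx w' v' z' k').
Proof.
move=> wE vE zE kE; apply/is_derive_mx; apply: ord2_ind; apply: ord2_ind;
rewrite [cartan_mx _ _ _ _ _ _]mxE /=; under eq_fun do rewrite mxE /=; by isder; ring.
Qed.

Lemma det_mx2E {R : realType} (A : 'M[R]_2) :
  \det A = A 0 0 * A 1 1 - A 0 1 * A 1 0.
Proof.
rewrite (expand_det_row _ 0) sum2 /cofactor !det_mx11 !mxE /=.
have -> : lift (0 : 'I_2) (0 : 'I_1) = 1 by exact: val_inj.
have -> : lift (1 : 'I_2) (0 : 'I_1) = 0 by exact: val_inj.
by rewrite /= expr0 expr1; ring.
Qed.

Lemma det_cartan_mx {R : realType} (w v z k : R) :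
  \det (cartan_mx w v z k) = 2^-1 * (w ^+ 2 + v ^+ 2 - z ^+ 2 - k ^+ 2).
Proof. by rewrite det_mx2E !mxE /= -sqrt2V_sqr; ring. Qed.

Lemma inner_cartan_mx {R : realType} (w v z k : R) :
  inner (cartan_mx w v z k) (cartan_mx w v z k) = w ^+ 2 + v ^+ 2 + z ^+ 2 + k ^+ 2.
Proof.
rewrite innerE !mxE /=.
transitivity (2 * (Num.sqrt 2)^-1 ^+ 2 * (w ^+ 2 + v ^+ 2 + z ^+ 2 + k ^+ 2)).
  by ring.
by rewrite sqrt2V_sqr divff ?mul1r.
Qed.

Lemma phi_psiE {R : realType} (q : 'cV[R]_3) :
  let rho := Num.sqrt (2 + q 0 0 ^+ 2) in
  phi (psi q) = cartan_mx (rho * cos (q 2 0)) (rho * sin (q 2 0))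
                          (q 0 0 * cos (q 1 0)) (q 0 0 * sin (q 1 0)).
Proof.
move=> rho; have [p0 p1 p2] := psiE q; rewrite phiE p0 p1 p2.
have -> // : 2 + (q 0 0 * cos (q 1 0)) ^+ 2 + (q 0 0 * sin (q 1 0)) ^+ 2 = 2 + q 0 0 ^+ 2.
transitivity (2 + q 0 0 ^+ 2 * (cos (q 1 0) ^+ 2 + sin (q 1 0) ^+ 2)); first ring.
by rewrite cos2Dsin2 mulr1.
Qed.

(** A plane curve in polar coordinates whose logarithmic radial speed [alpha]
    and angular speed [beta] satisfy [beta' = - 2 alpha beta] (constant angular
    momentum) has acceleration [mu] times its position. *)
Lemma polar_curve {R : realType} (r theta alpha beta mu : R -> R) :
  (forall t : R, is_derive t 1 r (r t * alpha t)) ->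
  (forall t : R, is_derive t 1 theta (beta t)) ->
  (forall t : R, is_derive t 1 alpha (mu t - alpha t ^+ 2 + beta t ^+ 2)) ->
  (forall t : R, is_derive t 1 beta (- 2 * alpha t * beta t)) ->
  let x t := r t * cos (theta t) in let y t := r t * sin (theta t) in
  let x' t := alpha t * x t - beta t * y t in
  let y' t := alpha t * y t + beta t * x t in
  forall t : R, [/\ is_derive t 1 x (x' t), is_derive t 1 y (y' t),
    is_derive t 1 x' (mu t * x t) & is_derive t 1 y' (mu t * y t)].
Proof.
move=> rE thE aE bE x y x' y' t.
have xE (s : R) : is_derive s 1 x (x' s) by rewrite /x' /x /y; isder; ring.
have yE (s : R) : is_derive s 1 y (y' s) by rewrite /y' /x /y; isder; ring.
split => //.
- by rewrite {1}/x'; isder; rewrite /x' /y'; ring.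
- by rewrite {1}/y'; isder; rewrite /x' /y'; ring.
Qed.

(** A matrix moving by the Hamiltonian system satisfies the second order
    equation. *)
Lemma motion_derivatives {R : realType} (kappa b e : R) (q p f g : R -> R) :
  (forall t, 0 < q t) ->
  (forall t : R, is_derive t 1 q (radial_velocity (q t) (p t))) ->
  (forall t : R, is_derive t 1 p (radial_force kappa b e (q t) (p t))) ->
  (forall t : R, is_derive t 1 f (b / q t ^+ 2)) ->
  (forall t : R, is_derive t 1 g (e / (2 + q t ^+ 2))) ->
  let rho t := Num.sqrt (2 + q t ^+ 2) in
  let A t := cartan_mx (rho t * cos (g t)) (rho t * sin (g t))
                       (q t * cos (f t)) (q t * sin (f t)) in
  exists (lambda : R -> R) (B : R -> 'M[R]_2), [/\ continuous lambda,
    forall t : R, is_derive t 1 A (B t) &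
    forall t : R, is_derive t 1 B (lambda t *: cof (A t) - kappa *: A t)].
Proof.
move=> q_pos qE pE fE gE rho A.
have n0 t : q t != 0 by rewrite gt_eqF.
have n1 t : 1 + q t ^+ 2 != 0 by exact: add_sqr_neq0.
have n2 t : 2 + q t ^+ 2 != 0 by exact: add_sqr_neq0.
have rho_pos t : 0 < 2 + q t ^+ 2 by rewrite ltr_pwDl// sqr_ge0.
have rho_sqr t : rho t ^+ 2 = 2 + q t ^+ 2 by rewrite sqr_sqrtr// ltW.
have rho0 t : rho t != 0 by rewrite gt_eqF// sqrtr_gt0.
pose V t := radial_velocity (q t) (p t).
pose G t := radial_force kappa b e (q t) (p t).
(* [rho' = rho * a1] and [g' = b1]; below, [q' = q * a2] and [f' = b2] *)
pose a1 t := q t * p t * (2 * (1 + q t ^+ 2))^-1.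
pose b1 t := e / (2 + q t ^+ 2).
pose a2 t := (2 + q t ^+ 2) * p t * (2 * (1 + q t ^+ 2))^-1 * (q t)^-1.
pose b2 t := b / q t ^+ 2.
(* [m1] is [a1' + a1 ^+ 2 - b1 ^+ 2] written out; that [m2] is the same
   expression in [a2] and [b2] is the radial equation *)
pose m1 t := (V t * p t + q t * G t) / (2 * (1 + q t ^+ 2))
   - q t ^+ 2 * p t * V t / (1 + q t ^+ 2) ^+ 2 + a1 t ^+ 2 - b1 t ^+ 2.
pose m2 t := - 2 * kappa - m1 t.
have rhoE (t : R) : is_derive t 1 rho (rho t * a1 t).
  rewrite /rho; isder => //.
  rewrite -/(rho t) /a1 /radial_velocity ?expr1.
  apply: (mulfI (rho0 t)).
  rewrite [RHS](_ : _ = rho t ^+ 2 * (q t * p t / (2 * (1 + q t ^+ 2)))); last by ring.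
  rewrite rho_sqr.
  by field; rewrite rho0 n1.
have a1E (t : R) : is_derive t 1 a1 (m1 t - a1 t ^+ 2 + b1 t ^+ 2).
  rewrite /a1; isder; first by rewrite mulf_neq0.
  by rewrite /m1 /V /G /a1; field; rewrite n1.
have b1E (t : R) : is_derive t 1 b1 (- 2 * a1 t * b1 t).
  by rewrite /b1; isder => //; rewrite /radial_velocity /a1; field; rewrite n1 n2.
have a2E (t : R) : is_derive t 1 a2 (m2 t - a2 t ^+ 2 + b2 t ^+ 2).
  rewrite /a2; isder; [by rewrite mulf_neq0|exact: n0|].
  rewrite /m2 /m1 /V /G /a1 /a2 /b1 /b2 /radial_force /radial_velocity; field.
  by rewrite n0 n1 n2.
have b2E (t : R) : is_derive t 1 b2 (- 2 * a2 t * b2 t).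
  rewrite /b2; isder; first by rewrite expf_neq0.
  by rewrite /radial_velocity /a2; field; rewrite n0 n1.
have qE' (t : R) : is_derive t 1 q (q t * a2 t).
  have -> // : q t * a2 t = radial_velocity (q t) (p t).
  by rewrite /a2 /radial_velocity; field; rewrite n0 n1.
have P1 := polar_curve rhoE gE a1E b1E.
have P2 := polar_curve qE' fE a2E b2E.
pose B t := cartan_mx
  (a1 t * (rho t * cos (g t)) - b1 t * (rho t * sin (g t)))
  (a1 t * (rho t * sin (g t)) + b1 t * (rho t * cos (g t)))
  (a2 t * (q t * cos (f t)) - b2 t * (q t * sin (f t)))
  (a2 t * (q t * sin (f t)) + b2 t * (q t * cos (f t))).
exists (fun t => m1 t + kappa), B; split.
- apply: derivable_continuous => t.
  rewrite /m1 /V /G /a1 /b1 /radial_force /radial_velocity; eexists; isder_step;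
  by rewrite ?mulf_neq0 ?expf_neq0 ?mulf_neq0.
- move=> t; have [x1 y1 _ _] := P1 t; have [x2 y2 _ _] := P2 t.
  exact: is_derive_cartan_mx.
- move=> t; have [_ _ x1 y1] := P1 t; have [_ _ x2 y2] := P2 t.
  have := is_derive_cartan_mx x1 y1 x2 y2; congr (is_derive _ _ _ _).
  rewrite /A cof_cartan_mx !scale_cartan_mx sub_cartan_mx.
  by congr cartan_mx; rewrite /m2; ring.
Qed.

(** * The constrained equation *)

(** The multiplier is determined by the constraint: differentiating
    [det A = 1] twice gives [lambda * |A|^2 = 2 * (kappa - det A')]. *)
Lemma SL2_multiplier {R : realType} (kappa : R) (lambda : R -> R)
    (A B : R -> 'M[R]_2) :
  (forall t, \det (A t) = 1) ->
  (forall t : R, is_derive t 1 A (B t)) ->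
  (forall t : R, is_derive t 1 B (lambda t *: cof (A t) - kappa *: A t)) ->
  forall t, 2 <= inner (A t) (A t) /\
    lambda t = 2 * (kappa - \det (B t)) / inner (A t) (A t).
Proof.
move=> detA AE BE t.
have AEs i j (s : R) : is_derive s 1 (fun s => A s i j) (B s i j).
  by have /is_derive_mx := AE s; apply.
have BEs i j (s : R) : is_derive s 1 (fun s => B s i j)
    (lambda s * cof (A s) i j - kappa * A s i j).
  by have /is_derive_mx/(_ i j) := BE s; rewrite !mxE.
pose a s := A s 0 0; pose b s := A s 0 1; pose c s := A s 1 0; pose d s := A s 1 1.
pose a' s := B s 0 0; pose b' s := B s 0 1; pose c' s := B s 1 0; pose d' s := B s 1 1.
have aE (s : R) : is_derive s 1 a (a' s) := AEs 0 0 s.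
have bE (s : R) : is_derive s 1 b (b' s) := AEs 0 1 s.
have cE (s : R) : is_derive s 1 c (c' s) := AEs 1 0 s.
have dE (s : R) : is_derive s 1 d (d' s) := AEs 1 1 s.
have a'E (s : R) : is_derive s 1 a' (lambda s * d s - kappa * a s).
  by have := BEs 0 0 s; rewrite cofE mxE.
have b'E (s : R) : is_derive s 1 b' (- (lambda s * c s) - kappa * b s).
  by have := BEs 0 1 s; rewrite cofE mxE /= mulrN.
have c'E (s : R) : is_derive s 1 c' (- (lambda s * b s) - kappa * c s).
  by have := BEs 1 0 s; rewrite cofE mxE /= mulrN.
have d'E (s : R) : is_derive s 1 d' (lambda s * a s - kappa * d s).
  by have := BEs 1 1 s; rewrite cofE mxE.
have det1 s : a s * d s - b s * c s = 1 by rewrite -(detA s) det_mx2E.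
have unique_derive (f : R -> R) (s x : R) : is_derive s 1 f x -> f = cst (f s) -> x = 0.
  by move=> [_ <-] ->; rewrite derive_cst.
have first_order s : a s * d' s + d s * a' s - (b s * c' s + c s * b' s) = 0.
  have D : is_derive s 1 (fun s => a s * d s - b s * c s)
      (a s * d' s + d s * a' s - (b s * c' s + c s * b' s)) by isder; ring.
  by apply: (unique_derive _ _ _ D); apply/funext => r; rewrite /= !det1.
have second_order : lambda t * (a t ^+ 2 + b t ^+ 2 + c t ^+ 2 + d t ^+ 2)
    - 2 * kappa * (a t * d t - b t * c t) + 2 * (a' t * d' t - b' t * c' t) = 0.
  have D : is_derive t 1 (fun s => a s * d' s + d s * a' s - (b s * c' s + c s * b' s))
      (lambda t * (a t ^+ 2 + b t ^+ 2 + c t ^+ 2 + d t ^+ 2)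
       - 2 * kappa * (a t * d t - b t * c t) + 2 * (a' t * d' t - b' t * c' t)).
    by isder; ring.
  by apply: (unique_derive _ _ _ D); apply/funext => r; rewrite /= !first_order.
have NE : inner (A t) (A t) = a t ^+ 2 + b t ^+ 2 + c t ^+ 2 + d t ^+ 2.
  by rewrite innerE /a /b /c /d; ring.
have N2 : 2 <= inner (A t) (A t).
  rewrite NE; have := det1 t.
  by have := sqr_ge0 (a t - d t); have := sqr_ge0 (b t + c t); nra.
split => //.
have N0 : inner (A t) (A t) != 0 by rewrite gt_eqF//; lra.
apply: (mulIf N0); rewrite divfK// det_mx2E NE -/(a' t) -/(b' t) -/(c' t) -/(d' t).
by move: second_order; rewrite det1; lra.
Qed.

Lemma SL2_solution_unique {R : realType} (kappa : R) (A0 B0 : 'M[R]_2)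
    (A1 A2 : R -> 'M[R]_2) :
  SL2_solution kappa A0 B0 A1 -> SL2_solution kappa A0 B0 A2 -> A1 = A2.
Proof.
have data A : SL2_solution kappa A0 B0 A -> exists lambda B, [/\
    forall t : R, is_derive t 1 A (B t),
    forall t : R, is_derive t 1 B (lambda t *: cof (A t) - kappa *: A t),
    forall t, \det (A t) = 1 & A 0 = A0 /\ B 0 = B0].
  move=> [[_ detA] [dA _] [lambda [_ lE]] [A_0 B_0]].
  exists lambda, A^`(); split => // t.
  - exact: (derive1_is_derive (dA 0%N t isT)).
  - apply: (derive1_is_derive (dA 1%N t isT)).
    by have := lE t; rewrite derive1nS derive1n1 => <-; rewrite addrK.
move=> /data[l1 [B1 [A1E B1E det1 [A1_0 B1_0]]]].
move=> /data[l2 [B2 [A2E B2E det2 [A2_0 B2_0]]]].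
have M1 := SL2_multiplier det1 A1E B1E; have M2 := SL2_multiplier det2 A2E B2E.
have entry (X Y : R -> 'M[R]_2) i j : (forall t : R, is_derive t 1 X (Y t)) ->
    forall t : R, is_derive t 1 (fun s => X s i j) (Y t i j).
  by move=> H t; have /is_derive_mx := H t; apply.
pose C1 t := l1 t *: cof (A1 t) - kappa *: A1 t.
pose C2 t := l2 t *: cof (A2 t) - kappa *: A2 t.
pose f (i : bool * ('I_2 * 'I_2)) t := if i.1
  then A1 t i.2.1 i.2.2 - A2 t i.2.1 i.2.2 else B1 t i.2.1 i.2.2 - B2 t i.2.1 i.2.2.
pose df (i : bool * ('I_2 * 'I_2)) t := if i.1
  then B1 t i.2.1 i.2.2 - B2 t i.2.1 i.2.2 else C1 t i.2.1 i.2.2 - C2 t i.2.1 i.2.2.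
suff f0 : forall i t, f i t = 0.
  apply/funext => t; apply/matrixP => i j; apply/eqP; rewrite -subr_eq0.
  by apply/eqP; exact: (f0 (true, (i, j)) t).
apply: (@gronwall_family_zero R _ f df).
- move=> [[] [i j]] t; rewrite /f /df /=.
    have := entry A1 B1 i j A1E t; have := entry A2 B2 i j A2E t => ? ?.
    exact: is_deriveB.
  have := entry B1 C1 i j B1E t; have := entry B2 C2 i j B2E t => ? ?.
  exact: is_deriveB.
- by move=> [[] [i j]]; rewrite /f /= ?A1_0 ?A2_0 ?B1_0 ?B2_0 subrr.
move=> T.
pose D := [set t : R | `|t| <= T].
pose d (t : R) := \sum_j `|f j t|.
have d0 t : 0 <= d t by apply: sumr_ge0.
have fd j t : `|f j t| <= 1 * d t.
  by rewrite mul1r /d (bigD1 j)//= lerDl sumr_ge0.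
have bounded (X Y : R -> 'M[R]_2) i j : (forall t : R, is_derive t 1 X (Y t)) ->
    exists C, forall t, D t -> `|X t i j| <= C.
  move=> H; apply: continuous_bounded_on; exact: is_derive_continuous (entry X Y i j H).
have AC i j : close_on D d (fun t => A1 t i j) (fun t => A2 t i j).
  apply: close_on_intro; [exact: d0| |exact: bounded A1E|exact: bounded A2E].
  by exists 1 => t _; exact: (fd (true, (i, j))).
have BC i j : close_on D d (fun t => B1 t i j) (fun t => B2 t i j).
  apply: close_on_intro; [exact: d0| |exact: bounded B1E|exact: bounded B2E].
  by exists 1 => t _; exact: (fd (false, (i, j))).
have A00 := AC 0 0; have A01 := AC 0 1; have A10 := AC 1 0; have A11 := AC 1 1.
have B00 := BC 0 0; have B01 := BC 0 1; have B10 := BC 1 0; have B11 := BC 1 1.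
have NC : close_on D d (fun t => (inner (A1 t) (A1 t))^-1)
                       (fun t => (inner (A2 t) (A2 t))^-1).
  apply: (@close_onV _ _ _ _ d0 2) => //.
  - by move=> t _; case: (M1 t).
  - by move=> t _; case: (M2 t).
  - under eq_fun do rewrite innerE; under [X in close_on _ _ _ X]eq_fun do rewrite innerE.
    by close_step.
have LC : close_on D d l1 l2.
  have lE (l : R -> R) (A B : R -> 'M[R]_2) :
      (forall t, l t = 2 * (kappa - \det (B t)) / inner (A t) (A t)) ->
      l = fun t => 2 * (kappa - (B t 0 0 * B t 1 1 - B t 0 1 * B t 1 0))
                   * (inner (A t) (A t))^-1.
    by move=> H; apply/funext => t; rewrite H det_mx2E.
  rewrite (lE l1 A1 B1); last by move=> t; case: (M1 t).
  rewrite (lE l2 A2 B2); last by move=> t; case: (M2 t).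
  by close_step.
have CC i j : close_on D d (fun t => C1 t i j) (fun t => C2 t i j).
  move: i j; apply: ord2_ind; apply: ord2_ind;
  under eq_fun do rewrite /C1 cofE !mxE /=;
  under [X in close_on _ _ _ X]eq_fun do rewrite /C2 cofE !mxE /=;
  by close_step.
move=> [[] [i j]].
- by have [C H] := BC i j; exists C => t tT; have [] := H t tT.
- by have [C H] := CC i j; exists C => t tT; have [] := H t tT.
Qed.

(** * Rotations and ellipses *)

Lemma matU_mulE {R : realType} (theta : R) (y : 'cV[R]_2) :
  (matU theta *m y) 0 0 = cos theta * y 0 0 - sin theta * y 1 0 /\
  (matU theta *m y) 1 0 = sin theta * y 0 0 + cos theta * y 1 0.
Proof. by rewrite /matU /matI /matZ !mxE !sum2 !mxE /=; split; ring. Qed.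

Lemma matU_orthogonal {R : realType} (theta : R) :
  (matU theta)^T *m matU theta = 1%:M /\ matU theta *m (matU theta)^T = 1%:M.
Proof.
have cs := cos2Dsin2 theta.
split; apply/matrixP; apply: ord2_ind; apply: ord2_ind;
  rewrite /matU /matI /matZ !mxE sum2 !mxE /= ?mulr1n ?mulr0n;
  first [ring | lra].
Qed.

Lemma matU_norm {R : realType} (theta : R) (y : 'cV[R]_2) :
  (matU theta *m y) 0 0 ^+ 2 + (matU theta *m y) 1 0 ^+ 2 = y 0 0 ^+ 2 + y 1 0 ^+ 2.
Proof.
have [-> ->] := matU_mulE theta y; set c := cos _; set n := sin _.
transitivity ((c ^+ 2 + n ^+ 2) * (y 0 0 ^+ 2 + y 1 0 ^+ 2)); first by ring.
by rewrite cos2Dsin2 mul1r.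
Qed.

(** A singular value decomposition displays the image of the disk as an
    ellipse, whose semi-axes are the singular values. *)
Lemma ellipse_of_svd {R : realType} (a b alpha beta : R) : 0 < a -> 0 < b ->
  is_ellipse a b
    [set matU alpha *m mx2 a 0 0 b *m matU beta *m y | y in unit_disk].
Proof.
move=> a0 b0; split => //; exists 0, (matU alpha).
split; first exact: (matU_orthogonal alpha).1.
have diagE (y : 'cV[R]_2) : (mx2 a 0 0 b *m y) 0 0 = a * y 0 0 /\
    (mx2 a 0 0 b *m y) 1 0 = b * y 1 0.
  by rewrite !mxE !sum2 !mxE /=; split; ring.
apply/seteqP; split=> [_ [y yD <-]|_ [z zE <-]].
  exists (mx2 a 0 0 b *m (matU beta *m y)); last by rewrite add0r -!mulmxA.
  rewrite /=; have [-> ->] := diagE (matU beta *m y).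
  rewrite ![_ * _ / _]mulrAC !divff ?gt_eqF// !mul1r matU_norm; exact: yD.
pose w : 'cV[R]_2 := \col_i (if i == 0 then z 0 0 / a else z 1 0 / b).
have w0 : w 0 0 = z 0 0 / a by rewrite mxE.
have w1 : w 1 0 = z 1 0 / b by rewrite mxE.
have bw : matU beta *m ((matU beta)^T *m w) = w.
  by rewrite mulmxA (matU_orthogonal beta).2 mul1mx.
exists ((matU beta)^T *m w).
  by rewrite /unit_disk /= -(matU_norm beta) bw w0 w1.
rewrite -!mulmxA bw add0r; congr (_ *m _).
have [d0 d1] := diagE w.
by apply/colP; apply: ord2_ind; rewrite ?d0 ?d1 ?w0 ?w1; field; rewrite gt_eqF.
Qed.

(** * From the Hamiltonian system to the matrix equation *)

(** The invariant [X2] is the angular momentum of the motion in polar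
    coordinates. *)
Lemma X2_polar {R : realType} (q v : 'cV[R]_3) :
  X2 (phi (psi q)) ('d phi (psi q) ('d psi q v)) = q 0 0 ^+ 2 * v 1 0.
Proof.
have [p0 p1 _] := psiE q; rewrite X2_diff_phi diff_psiE p0 p1 !mxE /=.
set c := cos _; set n := sin _.
transitivity (q 0 0 ^+ 2 * v 1 0 * (c ^+ 2 + n ^+ 2)); first by ring.
by rewrite cos2Dsin2 mulr1.
Qed.

Lemma continuous_cof_comb {R : realType} (lambda : R -> R) (kappa : R)
    (A : R -> 'M[R]_2) :
  continuous lambda -> continuous A ->
  continuous (fun t => lambda t *: cof (A t) - kappa *: A t).
Proof.
move=> cl /continuous_mx cA.
have comb i j (h : R -> R) : continuous h ->
    continuous (fun t => lambda t * h t - kappa * A t i j).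
  move=> ch t; apply: cvgB; apply: cvgM; [exact: cl|exact: ch|exact: cvg_cst|exact: cA].
have cN i j : continuous (fun t => - A t i j) by move=> t; apply: cvgN; exact: cA.
apply/continuous_mx; apply: ord2_ind; apply: ord2_ind;
under eq_fun do rewrite cofE !mxE /=; by apply: comb; first [exact: cA | exact: cN].
Qed.

Lemma global_solution_SL2 {R : realType} (kappa : R) (A0 B0 : 'M[R]_2)
    (q0 xi0 : 'cV[R]_3) (q xi : R -> 'cV[R]_3) :
  (Phi \o Gamma \o Psi) (q0, xi0) = (A0, B0) ->
  global_solution kappa q0 xi0 q xi -> SL2_solution kappa A0 B0 (phi \o psi \o q).
Proof.
move=> hinit /global_solution_coords[q_pos [q_0 xi_0] _ rad ang].
pose r t := q t 0 0; pose f t := q t 1 0; pose g t := q t 2 0; pose p t := xi t 0 0.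
have rE (t : R) : is_derive t 1 r (radial_velocity (r t) (p t)) := (rad t).1.
have pE (t : R) : is_derive t 1 p
  (radial_force kappa (xi0 1 0) (xi0 2 0) (r t) (p t)) := (rad t).2.
have fE (t : R) : is_derive t 1 f (xi0 1 0 / r t ^+ 2) := (ang t).1.
have gE (t : R) : is_derive t 1 g (xi0 2 0 / (2 + r t ^+ 2)) := (ang t).2.
have [lambda [B [cl]]] := motion_derivatives q_pos rE pE fE gE.
set A := fun t => cartan_mx _ _ _ _ => AE BE.
have phiA : phi \o psi \o q = A by apply/funext => t; rewrite /= phi_psiE.
have dA : A^`() = B by apply/funext => t; exact: is_derive_derive1.
have ddA t : A^`(2) t = lambda t *: cof (A t) - kappa *: A t.
  by rewrite derive1nS derive1n1 dA; exact: is_derive_derive1.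
have cA : continuous A := is_derive_continuous AE.
have cAs i j : continuous (fun t => A t i j) by exact: (continuous_mx A).1.
rewrite phiA; split.
- split=> // t; rewrite /SL2 /= /A det_cartan_mx.
  set c := cos (g t); set n := sin (g t); set c' := cos (f t); set n' := sin (f t).
  set rho := Num.sqrt _.
  transitivity (2^-1 * (rho ^+ 2 * (c ^+ 2 + n ^+ 2)
                        - q t 0 0 ^+ 2 * (c' ^+ 2 + n' ^+ 2))).
    by ring.
  rewrite !cos2Dsin2 !mulr1 /rho sqr_sqrtr; last by rewrite addr_ge0 ?sqr_ge0.
  by rewrite addrK mulVf.
- split.
    move=> [|[|//]] t _; rewrite ?derive1n0 ?derive1n1.
      by case: (AE t).
    by rewrite dA; case: (BE t).
  have -> : A^`(2) = fun t => lambda t *: cof (A t) - kappa *: A t by apply/funext.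
  exact: continuous_cof_comb.
- by exists lambda; split=> // t; rewrite ddA subrK.
- have q0_pos : R3plus q0 by rewrite -q_0; exact: q_pos.
  have : Phi ((Gamma \o Psi) (q0, xi0)) = (A0, B0) := hinit.
  rewrite Gamma_Psi// => -[A0E B0E].
  split; first by rewrite -phiA /= q_0.
  rewrite -B0E -phiA -q_0; apply: is_derive_derive1.
  apply: (@is_derive_curve _ _ _ phi (psi \o q)); first exact: differentiable_phi.
  apply: is_derive_curve; first exact: differentiable_psi.
  apply/is_derive_vec3; have [? ?] := ang 0; have [? _] := rad 0.
  by rewrite -xi_0; split => //; rewrite xi_0.
Qed.

(** Singular value decomposition of [phi (psi q)]. *)
Lemma phi_psi_svd {R : realType} (q : 'cV[R]_3) :
  phi (psi q) = (Num.sqrt 2)^-1 *: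
    (matU (2^-1 * (q 2 0 + q 1 0))
     *m (Num.sqrt (2 + q 0 0 ^+ 2) *: matI + q 0 0 *: matK)
     *m matU (2^-1 * (q 2 0 - q 1 0))).
Proof.
rewrite phi_psiE; set rho := Num.sqrt _.
set a := 2^-1 * (_ + _); set b := 2^-1 * (_ - _).
have -> : q 2 0 = a + b by rewrite /a /b; field.
have -> : q 1 0 = a - b by rewrite /a /b; field.
rewrite cosD sinD cosB sinB.
apply/esym/eq_mx2; rewrite /matU /matI /matZ /matK !mxE !sum2 !mxE !sum2 !mxE /=
  ?mulr1n ?mulr0n; ring.
Qed.

Lemma phi_psi_norm {R : realType} (q : 'cV[R]_3) :
  2^-1 * frob (phi (psi q)) ^+ 2 = 1 + q 0 0 ^+ 2.
Proof.
have -> : frob (phi (psi q)) ^+ 2 = 2 * (1 + q 0 0 ^+ 2).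
  rewrite /frob sqr_sqrtr phi_psiE inner_cartan_mx.
    rewrite !exprMn -addrA -!mulrDr !cos2Dsin2 !mulr1 sqr_sqrtr; first by ring.
    by rewrite addr_ge0 ?sqr_ge0.
  by rewrite !addr_ge0 ?sqr_ge0.
by rewrite mulKf.
Qed.

Lemma phi_psi_ellipse {R : realType} (q : 'cV[R]_3) : 0 < q 0 0 ->
  is_ellipse
    ((Num.sqrt 2)^-1 * (Num.sqrt (2 + q 0 0 ^+ 2) + q 0 0))
    ((Num.sqrt 2)^-1 * (Num.sqrt (2 + q 0 0 ^+ 2) - q 0 0))
    [set phi (psi q) *m y | y in unit_disk].
Proof.
move=> q_pos; set rho := Num.sqrt (2 + _).
have s0 : 0 < (Num.sqrt 2)^-1 :> R by rewrite invr_gt0 sqrtr_gt0.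
have q_lt : q 0 0 < rho.
  rewrite -(ger0_norm (ltW q_pos)) -sqrtr_sqr ltr_sqrt; first by rewrite ltrDr.
  by rewrite ltr_pwDl// sqr_ge0.
have -> : phi (psi q) = matU (2^-1 * (q 2 0 + q 1 0))
     *m mx2 ((Num.sqrt 2)^-1 * (rho + q 0 0)) 0 0 ((Num.sqrt 2)^-1 * (rho - q 0 0))
     *m matU (2^-1 * (q 2 0 - q 1 0)).
  rewrite phi_psi_svd -/rho scalemxAl scalemxAr; congr (_ *m _ *m _).
  by apply: eq_mx2; rewrite /matI /matK !mxE /=; ring.
by apply: ellipse_of_svd; rewrite mulr_gt0 ?subr_gt0// addr_gt0// (lt_trans q_pos).
Qed.

Unset Implicit Arguments.

Theorem theorem7p12 (R : realType) (kappa : R) (A0 B0 : 'M[R]_2)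
    (q0 xi0 : 'cV[R]_3)
    (hkappa : 0 <= kappa)
    (hAB : (calD `\` calD0) (A0, B0))
    (hX2 : X2 A0 B0 <> 0)
    (hq0 : R3plus q0)
    (hinit : (Phi \o Gamma \o Psi) (q0, xi0) = (A0, B0)) :
  (exists! z : (R -> 'cV[R]_3) * (R -> 'cV[R]_3),
     global_solution kappa q0 xi0 z.1 z.2) /\
  (forall q xi : R -> 'cV[R]_3,
     global_solution kappa q0 xi0 q xi ->
     let A : R -> 'M[R]_2 := phi \o psi \o q in
     let rho : R -> R := fun t => Num.sqrt (2 + q t 0 0 ^+ 2) in
     let Omega : R -> set 'cV[R]_2 := fun t => [set A t *m y | y in unit_disk] in
     [/\ unique (SL2_solution kappa A0 B0) A,
         (forall t, A t = (Num.sqrt 2)^-1 *: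
            (matU (2^-1 * (q t 2 0 + q t 1 0))
             *m (rho t *: matI + q t 0 0 *: matK)
             *m matU (2^-1 * (q t 2 0 - q t 1 0)))),
         (forall t, 2^-1 * frob (A t) ^+ 2 = 1 + q t 0 0 ^+ 2)
       & (forall t, is_ellipse
            ((Num.sqrt 2)^-1 * (Num.sqrt (2^-1 * frob (A t) ^+ 2 + 1)
                                + Num.sqrt (2^-1 * frob (A t) ^+ 2 - 1)))
            ((Num.sqrt 2)^-1 * (Num.sqrt (2^-1 * frob (A t) ^+ 2 + 1)
                                - Num.sqrt (2^-1 * frob (A t) ^+ 2 - 1)))
            (Omega t))]).
Proof.
have q0_neq0 : q0 0 0 != 0 by rewrite gt_eqF.
have xi2_neq0 : xi0 1 0 != 0.
  have : Phi ((Gamma \o Psi) (q0, xi0)) = (A0, B0) := hinit.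
  rewrite Gamma_Psi// => -[A0E B0E]; move: hX2; rewrite -A0E -B0E.
  rewrite X2_polar; have [_ -> _] := vec3E (radial_velocity (q0 0 0) (xi0 0 0))
    (xi0 1 0 / q0 0 0 ^+ 2) (xi0 2 0 / (2 + q0 0 0 ^+ 2)).
  rewrite mulrC divfK ?sqrf_eq0// => /eqP; exact.
split.
  have [q [xi sol]] := global_solution_exists hkappa hq0 xi2_neq0.
  exists (q, xi); split => // -[q' xi'] /= sol'.
  by have [-> ->] := global_solution_unique sol sol'.
move=> q xi sol A rho Omega.
have q_pos t : 0 < q t 0 0 by case: sol => _ _ h _ _; exact: h.
have normE t : 2^-1 * frob (A t) ^+ 2 = 1 + q t 0 0 ^+ 2 by exact: phi_psi_norm.
split.
- have solA := global_solution_SL2 hinit sol.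
  by split => // A' solA'; exact: SL2_solution_unique solA solA'.
- by move=> t; exact: phi_psi_svd.
- exact: normE.
- move=> t; rewrite normE.
  have -> : 1 + q t 0 0 ^+ 2 + 1 = 2 + q t 0 0 ^+ 2 by ring.
  have -> : 1 + q t 0 0 ^+ 2 - 1 = q t 0 0 ^+ 2 by ring.
  by rewrite sqrtr_sqr (ger0_norm (ltW (q_pos t))); exact: phi_psi_ellipse.
Qed.
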